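(* Let $(M,g,\mathcal K,\mathcal V)$ be a non-degenerate second order superintegrable system of dimension $n=\dim M\ge 2$ with structure tensor $\hat T$, and let $\nabla$ be the Levi-Civita connection of $g$. Let $\nabla^{\hat T}=\nabla-\hat T$ be its induced connection and let $\nabla^{\hat B}=\nabla-\hat B$, where $\hat B$ is defined by $g(\hat B(X,Y),Z)=B(X,Y,Z)$ with $B=T+\frac{n+2}{n}\,g\otimes t$. Then: (i) The connections $\nabla^{\hat T}$ and $\nabla^{\hat B}$ share the same dual-geodesics. (ii) There is a unique torsion-free affine connection $\nabla^\star$ that is dual-projectively equivalent to $\nabla^{\hat T}$ and such that the pair $(\nabla^\star,g)$ is compatible. In fact, $\nabla^\star=\nabla^{\hat B}$.
   Context: **Setting.** $(M,g)$ is a smooth, connected, simply connected Riemannian manifold of dimension $n$, with Levi-Civita connection $\nabla$ and Laplace-Beltrami operator $\Delta$; $\flat$ and $\sharp$ are the musical isomorphisms of $g$. Affine connections are extended to $1$-forms and tensor fields in the usual way. All connections considered are torsion-free. **Dual-geodesics.** A smooth curve $\gamma:(-\varepsilon,\varepsilon)\to M$ is *dual-geodesic* for an affine connection $\nabla'$ if $\nabla'_{\dot\gamma}\dot\gamma^\flat=q(t)\,\dot\gamma^\flat$ for some function $q:(-\varepsilon,\varepsilon)\to\mathbb R$, where $\dot\gamma^\flat=g(\dot\gamma,\cdot)$. Two connections are *dual-projectively equivalent* if they share the same dual-geodesic curves. **Compatibility.** A pair $(\nabla',h)$ of an affine connection and a metric is *semi-compatible via* a $1$-form $\alpha$ if $(\nabla'_Xh)(Y,Z)-(\nabla'_Yh)(X,Z)=\alpha(Y)h(X,Z)-\alpha(X)h(Y,Z)$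 for all $X,Y,Z\in\mathfrak X(M)$. It is *compatible* if it is semi-compatible via $\alpha=0$. **Superintegrable systems.** Consider a Hamiltonian $H(x,p)=g_x^{-1}(p,p)+V(x)$ on $T^*M$ (with its canonical symplectic form). It is (maximally) superintegrable of second order if there are $2n-2$ functions $F^{(m)}=K_{(m)}^{ij}(x)p_ip_j+W^{(m)}(x)$, constant along the Hamiltonian flow of $H$, such that $H,F^{(1)},\dots,F^{(2n-2)}$ are functionally independent. The associated tensors $g_{ai}g_{bj}K^{ab}\,dx^i\otimes dx^j$ are Killing tensors, i.e. symmetric with $(\nabla_XK)(X,X)=0$ for all $X$. The system is *irreducible* if the endomorphisms of $TM$ associated via $g$ to the Killing tensors of the integrals of motion form an irreducible set, i.e. do not share a common eigenspace. **Non-degenerate systems.** A *non-degenerate system* is a quadruple $(M,g,\mathcal K,\mathcal V)$, where $\mathcal K$ is a linear space of Killing tensors of dimension at least $2n-1$ with $g\in\mathcal K$, whose associated space of endomorphisms is irreducible, and $\mathcal V\subset\mathcal C^\infty(M)$ is a linear subspace of dimension $n+2$, such that $d(K(dV))=0$ for all $V\in\mathcal V$ and all endomorphisms $K$ with $K^\flat\in\mathcal K$ (so that the $K$ with $K^\flat\in\mathcal K$ give second order integrals of the motion of a second order superintegrable system for the potentials $V\in\mathcal V$). **Structure tensor.** For such a system there is a unique tensor field $\hat T\in\Gamma(\mathrm{Sym}^2_\circ(T^*M)\otimes TM)$ (symmetric and $g$-trace-free in its two covariant arguments), depending only on $\mathcal K$, such that for all $V\in\mathcal V$ $$\nabla^2V=\hat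 T(dV)+\tfrac1n\,g\,\Delta V,\qquad \hat T(dV)(X,Y)=dV(\hat T(X,Y)).$$ Put $T(X,Y,Z)=g(\hat T(X,Y),Z)$ and $t=\frac{n}{(n-1)(n+2)}\mathrm{tr}(\hat T)\in\Omega^1(M)$, where $\mathrm{tr}(\hat T)(X)$ is the trace of $Y\mapsto\hat T(X,Y)$. It is known that for non-degenerate systems $$T(X,Y,Z)=S(X,Y,Z)+t(X)g(Y,Z)+t(Y)g(X,Z)-\tfrac2n\,t(Z)g(X,Y)$$ with a totally symmetric, trace-free tensor field $S\in\Gamma(\mathrm{Sym}^3_\circ(T^*M))$; in particular $B=T+\frac{n+2}{n}g\otimes t$, where $(g\otimes t)(X,Y,Z)=g(X,Y)t(Z)$, is totally symmetric. **Connections.** For $\hat A\in\Gamma(\mathrm{Sym}^2(T^*M)\otimes TM)$, the connection $\nabla-\hat A$ is given by $X,Y\mapsto\nabla_XY-\hat A(X,Y)$. *)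

(* Defs.v *)
From HB Require Import structures.
From mathcomp Require Import all_boot all_order all_algebra.
From mathcomp Require Import all_classical all_reals all_analysis.
Import Order.TTheory GRing.Theory Num.Theory.
Import numFieldNormedType.Exports.
Set Implicit Arguments.
Unset Strict Implicit.
Unset Printing Implicit Defensive.
Local Open Scope classical_set_scope.
Local Open Scope ring_scope.

Section LinearAlgebra.
Context {R : realType} {E : lmodType R}.

Definition linear_subspace (S : set E) :=
  S 0 /\ forall (c : R) u v, S u -> S v -> S (c *: u + v).

Definition lin_indep m (b : 'I_m -> E) :=
  forall c : 'I_m -> R, \sum_i c i *: b i = 0 -> forall i, c i = 0.

Definition has_dim (S : set E) (d : nat) :=
  exists b : 'I_d -> E, [/\ forall i, S (b i), lin_indep b &
    forall v, S v -> exists c : 'I_d -> R, v = \sum_i c i *: b i].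

Definition dim_at_least (S : set E) (d : nat) :=
  exists b : 'I_d -> E, (forall i, S (b i)) /\ lin_indep b.

End LinearAlgebra.

Section Calculus.
Context {R : realType} {n : nat}.

Definition partial (i : 'I_n) (f : 'rV[R]_n -> R) : 'rV[R]_n -> R :=
  fun x => derive f x (delta_mx 0 i).

(* All iterated partial derivatives are (Frechet) differentiable at each point
   of D.  For D open, this is C^oo on D. *)
Definition smooth_on (D : set 'rV[R]_n) (f : 'rV[R]_n -> R) :=
  forall (s : seq 'I_n) x, D x -> differentiable (foldr partial f s) x.

End Calculus.

(* A smooth n-manifold, presented by an atlas: [param a] is the inverse of the
   coordinate map [coord a] of the chart [a]; both are total functions, whose
   values are relevant only on [dom a] and on its image. *)
Record smooth_manifold (R : realType) (n : nat) := SmoothManifold {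
  carrier :> topologicalType;
  chart : Type;
  dom : chart -> set carrier;
  coord : chart -> carrier -> 'rV[R]_n;
  param : chart -> 'rV[R]_n -> carrier;
  manifold_hausdorff : hausdorff_space carrier;
  manifold_second_countable : @second_countable carrier;
  dom_cover : forall p, exists a, dom a p;
  dom_open : forall a, open (dom a);
  image_open : forall a, open (coord a @` dom a);
  coordK : forall a p, dom a p -> param a (coord a p) = p;
  coord_continuous : forall a p, dom a p -> {for p, continuous (coord a)};
  param_continuous :
    forall a x, (coord a @` dom a) x -> {for x, continuous (param a)};
  transition_smooth : forall a b k,
    smooth_on (coord a @` (dom a `&` dom b))
      (fun x => coord b (param a x) 0 k) }.

Definition simply_connected (R : realType) (T : topologicalType) :=
  forall f : R -> T, {within `[0, 1]%classic, continuous f} -> f 0 = f 1 ->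
  exists H : R * R -> T,
    [/\ {within `[0, 1]%classic `*` `[0, 1]%classic, continuous H},
        forall t, t \in `[0, 1] -> H (0, t) = f t,
        forall t, t \in `[0, 1] -> H (1, t) = f 0 &
        forall s, s \in `[0, 1] -> H (s, 0) = f 0 /\ H (s, 1) = f 0].

Section Geometry.
Context {R : realType} {n : nat} (M : smooth_manifold R n).
Implicit Types (a b : chart M) (p q : M) (X Y Z : 'rV[R]_n).

Definition smooth_comp a (f : M -> R) :=
  smooth_on (coord a @` dom a) (f \o param a).

Definition smooth_fun (f : M -> R) := forall a, smooth_comp a f.

(* The partial derivative of f at p with respect to the i-th coordinate of the
   chart a. *)
Definition pd a (i : 'I_n) (f : M -> R) : M -> R :=
  fun p => partial i (f \o param a) (coord a p).

(* d_i^a = \sum_l (jac a b p i l) d_l^b at p *)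
Definition jac a b p : 'M[R]_n :=
  \matrix_(i, l) pd a i (fun q => coord b q 0 l) p.

(* Tensor fields and connections are given by their components with respect to
   the coordinate frame of each chart a, at each point p; the components in
   overlapping charts are related by the usual transformation law.  Tangent
   vectors at p are row vectors of components.

   Components at points outside the domain of the chart are required to be 0,
   so that Leibniz equality of families of components is equality of fields,
   and tensor fields form a linear subspace of a function space. *)
Definition field1 := chart M -> M -> 'rV[R]_n.
Definition field2 := chart M -> M -> 'M[R]_n.
Definition field3 := chart M -> M -> 'I_n -> 'I_n -> 'I_n -> R.

Definition eval1 (w : 'rV[R]_n) X : R := \sum_i w 0 i * X 0 i.
Definition eval2 (h : 'M[R]_n) X Y : R :=
  \sum_i \sum_j h i j * X 0 i * Y 0 j.
Definition eval3 (A : 'I_n -> 'I_n -> 'I_n -> R) X Y Z : R :=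
  \sum_i \sum_j \sum_k A i j k * X 0 i * Y 0 j * Z 0 k.

(* Sections of T*M (x) T*M, with h_ij = h(d_i, d_j). *)
Definition tensor02 (h : field2) := [/\
  forall a i j, smooth_comp a (fun p => h a p i j),
  forall a b p, dom a p -> dom b p ->
    h a p = jac a b p *m h b p *m (jac a b p)^T &
  forall a p, ~ dom a p -> h a p = 0].

Definition symmetric02 (h : field2) := forall a p, h a p = (h a p)^T.

(* Sections of T*M (x) T*M (x) TM, with A(d_i, d_j) = \sum_k A i j k d_k. *)
Definition tensor12 (A : field3) := [/\
  forall a i j k, smooth_comp a (fun p => A a p i j k),
  forall a b p, dom a p -> dom b p -> forall i j r,
    \sum_k A a p i j k * jac a b p k r =
    \sum_l \sum_m jac a b p i l * jac a b p j m * A b p l m r &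
  forall a p, ~ dom a p -> forall i j k, A a p i j k = 0].

(* Affine connections, given by Christoffel symbols:
   nabla_{d_i} d_j = \sum_k N i j k d_k.  The inhomogeneous transformation law
   is the Leibniz rule applied to d_j^a = \sum_l (jac a b j l) d_l^b. *)
Definition affine_connection (N : field3) := [/\
  forall a i j k, smooth_comp a (fun p => N a p i j k),
  forall a b p, dom a p -> dom b p -> forall i j r,
    \sum_k N a p i j k * jac a b p k r =
    pd a i (fun q => jac a b q j r) p +
    \sum_l \sum_m jac a b p i l * jac a b p j m * N b p l m r &
  forall a p, ~ dom a p -> forall i j k, N a p i j k = 0].

Definition torsion_free (N : field3) :=
  forall a p i j k, N a p i j k = N a p j i k.

Definition conn_sub (N A : field3) : field3 :=
  fun a p i j k => N a p i j k - A a p i j k.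

Definition differential (V : M -> R) : field1 :=
  fun a p => \row_i pd a i V p.

Definition ext_deriv (w : field1) : field2 :=
  fun a p => \matrix_(i, j)
    (pd a i (fun q => w a q 0 j) p - pd a j (fun q => w a q 0 i) p).

(* In both covariant derivatives the first index is the direction of
   differentiation. *)
Definition cov1 (N : field3) (w : field1) : field2 :=
  fun a p => \matrix_(i, j)
    (pd a i (fun q => w a q 0 j) p - \sum_k N a p i j k * w a p 0 k).

Definition cov2 (N : field3) (h : field2) : field3 :=
  fun a p i j k => pd a i (fun q => h a q j k) p
    - \sum_m N a p i j m * h a p m k - \sum_m N a p i k m * h a p j m.

Definition riemannian_metric (g : field2) := [/\ tensor02 g, symmetric02 g &
  forall a p, dom a p -> forall X, X != 0 -> 0 < eval2 (g a p) X X].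

Definition levi_civita (g : field2) (N : field3) := [/\
  affine_connection N, torsion_free N &
  forall a p, dom a p -> forall X Y Z, eval3 (cov2 N g a p) X Y Z = 0].

Definition hessian (N : field3) (V : M -> R) : field2 :=
  cov1 N (differential V).

Definition laplacian (g : field2) (N : field3) (V : M -> R) a p : R :=
  \tr (invmx (g a p) *m hessian N V a p).

(* Acting on row vectors of components by right multiplication, this is the
   endomorphism X |-> K(X, .)^sharp; its dual acts on 1-forms through the
   transpose. *)
Definition endo (g K : field2) : field2 :=
  fun a p => K a p *m invmx (g a p).

Definition endo_form (g K : field2) (w : field1) : field1 :=
  fun a p => w a p *m (endo g K a p)^T.

Definition killing_tensor (N : field3) (K : field2) := [/\
  tensor02 K, symmetric02 K &
  forall a p, dom a p -> forall X, eval3 (cov2 N K a p) X X X = 0].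

(* W, the row space of a nonzero matrix, is a nonzero subspace of T_pM on which
   each of the endomorphisms acts as a scalar. *)
Definition irreducible_set (g : field2) (KK : set field2) :=
  forall a p, dom a p -> ~ exists W : 'M[R]_n, W != 0 /\
    forall K, KK K -> exists c : R, (W <= eigenspace (endo g K a p) c)%MS.

Record nondegenerate_system (g : field2) (N : field3)
    (KK : set field2) (VV : set (M -> R)) : Prop := {
  nds_connected : connected [set: M];
  nds_simply_connected : simply_connected R M;
  nds_metric : riemannian_metric g;
  nds_levi_civita : levi_civita g N;
  nds_K_subspace : linear_subspace (KK : set (chart M -> M -> 'M[R]_n));
  nds_K_killing : forall K, KK K -> killing_tensor N K;
  nds_K_dim :
    dim_at_least (KK : set (chart M -> M -> 'M[R]_n)) (2 * n - 1)%N;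
  nds_K_metric : KK g;
  nds_irreducible : irreducible_set g KK;
  nds_V_smooth : forall V, VV V -> smooth_fun V;
  nds_V_subspace : linear_subspace VV;
  nds_V_dim : has_dim VV (n + 2)%N;
  nds_closed : forall K V, KK K -> VV V -> forall a p, dom a p ->
    ext_deriv (endo_form g K (differential V)) a p = 0 }.

Definition structure_tensor (g : field2) (N : field3) (VV : set (M -> R))
    (That : field3) := [/\
  tensor12 That,
  forall a p i j k, That a p i j k = That a p j i k,
  forall a p, dom a p -> forall k,
    \sum_i \sum_j invmx (g a p) i j * That a p i j k = 0 &
  forall V, VV V -> forall a p, dom a p -> forall i j,
    hessian N V a p i j =
      \sum_k That a p i j k * differential V a p 0 k
      + n%:R^-1 * g a p i j * laplacian g N V a p].

Definition lower3 (g : field2) (A : field3) : field3 :=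
  fun a p i j l => \sum_k A a p i j k * g a p k l.

Definition raise3 (g : field2) (A : field3) : field3 :=
  fun a p i j k => \sum_l A a p i j l * invmx (g a p) l k.

Definition t_form (That : field3) : field1 :=
  fun a p => \row_i
    (n%:R / ((n%:R - 1) * (n%:R + 2)) * \sum_j That a p i j j).

Definition B_tensor (g : field2) (That : field3) : field3 :=
  fun a p i j k => lower3 g That a p i j k
    + (n%:R + 2) / n%:R * g a p i j * t_form That a p 0 k.

Definition Bhat (g : field2) (That : field3) : field3 :=
  raise3 g (B_tensor g That).

Definition smooth_curve (eps : R) (c : R -> M) :=
  forall t, t \in `]- eps, eps[ ->
    {for t, continuous c} /\
    forall a, dom a (c t) -> forall i m,
      derivable (derive1n m (fun s => coord a (c s) 0 i)) t 1.

Definition velocity (c : R -> M) a (t : R) : 'rV[R]_n :=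
  \row_i derive1 (fun s => coord a (c s) 0 i) t.

Definition velocity_flat (g : field2) (c : R -> M) a (t : R) : 'rV[R]_n :=
  velocity c a t *m g a (c t).

(* The covariant derivative along c of a 1-form w along c. *)
Definition cov_along (N : field3) (c : R -> M)
    (w : chart M -> R -> 'rV[R]_n) a (t : R) : 'rV[R]_n :=
  \row_j (derive1 (fun s => w a s 0 j) t
    - \sum_i \sum_k N a (c t) i j k * velocity c a t 0 i * w a t 0 k).

Definition dual_geodesic (g : field2) (N : field3) (eps : R) (c : R -> M) :=
  smooth_curve eps c /\
  exists q : R -> R, forall t, t \in `]- eps, eps[ ->
    forall a, dom a (c t) ->
      cov_along N c (velocity_flat g c) a t = q t *: velocity_flat g c a t.

Definition dual_projectively_equivalent (g : field2) (N N' : field3) :=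
  forall (eps : R) (c : R -> M), 0 < eps ->
    (dual_geodesic g N eps c <-> dual_geodesic g N' eps c).

Definition semi_compatible (N : field3) (h : field2) (alpha : field1) :=
  forall a p, dom a p -> forall X Y Z,
    eval3 (cov2 N h a p) X Y Z - eval3 (cov2 N h a p) Y X Z =
    eval1 (alpha a p) Y * eval2 (h a p) X Z
    - eval1 (alpha a p) X * eval2 (h a p) Y Z.

Definition compatible (N : field3) (h : field2) :=
  semi_compatible N h (fun _ _ => 0).

End Geometry.

Arguments field1 {R n} M.
Arguments field2 {R n} M.
Arguments field3 {R n} M.

(* Main.v *)
From mathcomp Require Import all_boot all_order all_algebra.
From mathcomp Require Import all_classical all_reals all_analysis.
From mathcomp Require Import ring lra.
Require Import Defs.
Import Order.TTheory GRing.Theory Num.Theory.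
Import numFieldNormedType.Exports.
Set Implicit Arguments.
Unset Strict Implicit.
Unset Printing Implicit Defensive.
Local Open Scope classical_set_scope.
Local Open Scope ring_scope.

(** Lower the last index of That to get T.  The heart of the matter is that
   B = T + (n + 2)/n g (x) t is totally symmetric; everything else is tensor
   calculus, plus the existence of enough dual-geodesics.

   Total symmetry of B.  In a chart, put G = Gamma + That.  The equation of the
   structure tensor reads d_i d_j V = G_ij^k d_k V + g_ij L / n, where L is the
   Laplacian of V.  Differentiate it and exchange two derivatives
   ([integrability]): the result is a linear relation between dV, L and dL.
   Its contraction with the inverse metric expresses dL through dV and L
   ([partial_trace_term]), so V, dV and L solve a total linear system of first
   order, and on a connected manifold V is determined by their values at one
   point ([hessian_solution_eq0]).  As the potentials form a space of dimension
   n + 2, some nonzero potential satisfies V = 0 and dV = 0 at a given point p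
   ([exists_critical_potential]), and its Laplacian cannot vanish at p.  For
   this potential only the terms in L survive in the integrability relation,
   and they say T_ijk - T_kji = (g_kj tau_i - g_ij tau_k) / (n - 1), where tau
   is the trace of That.  By the choice of the constants in t and in B this is
   the symmetry of B in its outer indices ([B_tensor_swap13]); the symmetry in
   the first two is clear.

   Part (i).  The lowered tensors of nabla^T and nabla^B differ by a multiple
   of g (x) t.  Along a curve with velocity v this changes the covariant
   derivative of v^flat by a multiple of t(v) v^flat, which the factor q in the
   definition of a dual-geodesic absorbs ([dual_geodesic_shift]).

   Part (ii).  The covariant derivative of g for nabla - A is the symmetrization of
   the lowered tensor A in its last two arguments, so that nabla^B is compatible because B is totally symmetric
   ([compatible_sub]).  Conversely, let N be another solution.  The lowered
   difference of N and nabla^B is totally symmetric, by compatibility and the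
   absence of torsion.  Through every vector v runs a common dual-geodesic
   ([dual_geodesic_exists]), hence the difference sends (v, v) to a multiple of
   v^flat, and a cubic form with this property is zero ([cubic_form_eq0]).

   The analysis behind this: smooth functions are closed under the algebraic
   operations and matrix inversion, mixed derivatives commute, total linear
   systems have unique solutions (Gronwall), and ordinary differential
   equations with smooth coefficients have smooth local solutions (Picard). *)

(** * Functions of class C^k on open sets of R^n *)

Section FiniteSmoothness.
Context {R : realType} {n : nat}.
Implicit Types (D : set 'rV[R]_n) (f h : 'rV[R]_n -> R).

Lemma diff_partial f x v : differentiable f x ->
  'd f x v = \sum_i v 0 i * partial i f x.
Proof.
move=> df; rewrite {1}(row_sum_delta v) linear_sum; apply: eq_bigr => i _.
by rewrite linearZ /partial deriveE.
Qed.

Lemma near_eq_partial f h x i :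
  (\forall y \near x, f y = h y) -> partial i f x = partial i h x.
Proof.
move=> fh; rewrite /partial.
have [->|n0] := eqVneq (delta_mx 0 i : 'rV[R]_n) 0; first by rewrite !derive0.
exact: near_eq_derive.
Qed.

(** Differentiability at x only sees the germ of the function at x, although
   the differential is selected by a choice operator. *)
Lemma near_eq_differentiable f h x :
  (\forall y \near x, f y = h y) -> differentiable f x -> differentiable h x.
Proof.
move=> fh; have fh' := fh; move=> /diff_locallyP[cf ef].
have eh : h \o shift x = cst (h x) + 'd f x +o_ 0 id.
  apply/eqaddoP => e e0; have /eqaddoP/(_ e e0) := ef.
  move: fh; rewrite (near_shift 0 x) => fh.
  apply: filter_app; move: fh; apply: filter_app; near=> z.
  move=> /= fz; rewrite !fctE /= (nbhs_singleton fh').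
  by rewrite subr0 in fz; rewrite fz.
by apply/diff_locallyP; rewrite (diff_unique cf eh).
Unshelve. all: by end_near. Qed.

(** The recursion on k allows inductions in which the derivative of an
   expression contains the expression itself, as for products and inverses. *)
Fixpoint smoothk k D f : Prop :=
  if k is k'.+1 then
    (forall x, D x -> differentiable f x) /\
    forall i, smoothk k' D (partial i f)
  else True.

Lemma smooth_onP D f : smooth_on D f <-> forall k, smoothk k D f.
Proof.
split=> [+ k|].
  elim: k f => [//|k IH] f sf; split=> [x Dx|i]; first exact: (sf [::] x Dx).
  by apply: IH => s x Dx; rewrite -foldr_rcons; apply: sf.
move=> sf s x Dx; have := sf (size s).+1.
elim/last_ind: s f {sf} => [|s i IH] f; first by case=> + _; apply.
by rewrite size_rcons foldr_rcons => -[_ /(_ i)]; apply: IH.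
Qed.

Lemma partialD f h x i : differentiable f x -> differentiable h x ->
  partial i (fun y => f y + h y) x = partial i f x + partial i h x.
Proof. by move=> df dh; rewrite /partial [LHS]deriveD//; exact: diff_derivable. Qed.

Lemma partialM f h x i : differentiable f x -> differentiable h x ->
  partial i (fun y => f y * h y) x = f x * partial i h x + partial i f x * h x.
Proof.
move=> df dh; rewrite /partial [LHS]deriveM; try exact: diff_derivable.
by rewrite [h x *: _]mulrC.
Qed.

Lemma partialV f x i : differentiable f x -> f x != 0 ->
  partial i (fun y => (f y)^-1) x = - (partial i f x * ((f x)^-1 * (f x)^-1)).
Proof.
move=> df f0; rewrite /partial [LHS]deriveV//; last exact: diff_derivable.
by rewrite /GRing.scale/= mulNr mulrC -invfM -expr2.
Qed.

Lemma partial_cst (c : R) x i : partial i (cst c : 'rV[R]_n -> R) x = 0.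
Proof. exact: derive_cst. Qed.

Lemma smoothkW k D f : smoothk k.+1 D f -> smoothk k D f.
Proof.
by elim: k f => [//|k IH] f [df sf]; split=> // i; exact/IH/sf.
Qed.

Lemma smoothk_ext k D f h : open D -> {in D, f =1 h} ->
  smoothk k D f -> smoothk k D h.
Proof.
move=> oD; elim: k f h => [//|k IH] f h fh [df sf].
have nfh x : D x -> \forall y \near x, f y = h y.
  move=> Dx; have := open_nbhs_nbhs (conj oD Dx).
  by apply: filterS => y Dy; apply: fh; rewrite inE.
split=> [x Dx|i]; first exact: near_eq_differentiable (nfh x Dx) (df x Dx).
apply: IH (sf i) => x; rewrite inE => Dx; exact/near_eq_partial/nfh.
Qed.

Lemma smoothk_cst k D (c : R) : smoothk k D (cst c).
Proof.
elim: k c => [//|k IH] c; split=> [x _|i]; first exact: differentiable_cst.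
by rewrite (_ : partial i _ = cst 0) //; apply/funext => x; rewrite partial_cst.
Qed.

Lemma smoothkD k D f h : open D -> smoothk k D f -> smoothk k D h ->
  smoothk k D (fun x => f x + h x).
Proof.
move=> oD; elim: k f h => [//|k IH] f h [df sf] [dh sh].
split=> [x Dx|i]; first by apply: differentiableD; [exact: df|exact: dh].
apply: (smoothk_ext oD _ (IH _ _ (sf i) (sh i))) => x; rewrite inE => Dx.
by rewrite partialD//; [exact: df|exact: dh].
Qed.

Lemma smoothkM k D f h : open D -> smoothk k D f -> smoothk k D h ->
  smoothk k D (fun x => f x * h x).
Proof.
move=> oD; elim: k f h => [//|k IH] f h Sf Sh.
have [[df sf] [dh sh]] := (Sf, Sh).
split=> [x Dx|i]; first by apply: differentiableM; [exact: df|exact: dh].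
apply: (smoothk_ext oD _ (smoothkD oD (IH _ _ (smoothkW Sf) (sh i))
  (IH _ _ (sf i) (smoothkW Sh)))) => x; rewrite inE => Dx.
by rewrite partialM//; [exact: df|exact: dh].
Qed.

Lemma smoothkV k D f : open D -> (forall x, D x -> f x != 0) ->
  smoothk k D f -> smoothk k D (fun x => (f x)^-1).
Proof.
move=> oD f0; elim: k => [//|k IH] Sf; have [df sf] := Sf.
split=> [x Dx|i]; first by apply: differentiableV; [exact: df|exact: f0].
have Sv := IH (smoothkW Sf).
apply: (smoothk_ext oD _ (smoothkM oD (smoothk_cst k D (-1))
  (smoothkM oD (sf i) (smoothkM oD Sv Sv)))) => x; rewrite inE => Dx.
by rewrite partialV ?mulN1r//; [exact: df|exact: f0].
Qed.

Lemma smooth_on_cst D (c : R) : smooth_on D (fun=> c).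
Proof. by apply/smooth_onP => k; exact: smoothk_cst. Qed.

Lemma smooth_on_ext D f h : open D -> {in D, f =1 h} ->
  smooth_on D f -> smooth_on D h.
Proof.
by move=> oD fh /smooth_onP sf; apply/smooth_onP => k; exact: smoothk_ext (sf k).
Qed.

Lemma smooth_onD D f h : open D -> smooth_on D f -> smooth_on D h ->
  smooth_on D (fun x => f x + h x).
Proof.
move=> oD /smooth_onP sf /smooth_onP sh; apply/smooth_onP => k; exact: smoothkD.
Qed.

Lemma smooth_onM D f h : open D -> smooth_on D f -> smooth_on D h ->
  smooth_on D (fun x => f x * h x).
Proof.
move=> oD /smooth_onP sf /smooth_onP sh; apply/smooth_onP => k; exact: smoothkM.
Qed.

Lemma smooth_onV D f : open D -> (forall x, D x -> f x != 0) ->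
  smooth_on D f -> smooth_on D (fun x => (f x)^-1).
Proof. by move=> oD f0 /smooth_onP sf; apply/smooth_onP => k; exact: smoothkV. Qed.

Lemma smooth_onN D f : open D -> smooth_on D f -> smooth_on D (fun x => - f x).
Proof.
move=> oD sf; rewrite (_ : (fun x => _) = (fun x => -1 * f x)).
  exact/smooth_onM/sf/smooth_on_cst.
by apply/funext => x; rewrite mulN1r.
Qed.

Lemma smooth_on_sum D I (r : seq I) (P : pred I) (F : I -> 'rV[R]_n -> R) :
  open D -> (forall i, P i -> smooth_on D (F i)) ->
  smooth_on D (fun x => \sum_(i <- r | P i) F i x).
Proof.
move=> oD sF; elim: r => [|j r IH].
  by under eq_fun do rewrite big_nil; exact: smooth_on_cst.
case Pj: (P j); last by under eq_fun do rewrite big_cons Pj.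
under eq_fun do rewrite big_cons Pj.
exact/smooth_onD/IH/sF.
Qed.

Lemma smooth_on_prod D I (r : seq I) (P : pred I) (F : I -> 'rV[R]_n -> R) :
  open D -> (forall i, P i -> smooth_on D (F i)) ->
  smooth_on D (fun x => \prod_(i <- r | P i) F i x).
Proof.
move=> oD sF; elim: r => [|j r IH].
  by under eq_fun do rewrite big_nil; exact: smooth_on_cst.
case Pj: (P j); last by under eq_fun do rewrite big_cons Pj.
under eq_fun do rewrite big_cons Pj.
exact/smooth_onM/IH/sF.
Qed.

Lemma smooth_on_partial D f i : smooth_on D f -> smooth_on D (partial i f).
Proof. by move=> sf s x Dx; rewrite -foldr_rcons; exact: sf. Qed.

Lemma smooth_on_det D m (A : 'rV[R]_n -> 'M[R]_m) : open D ->
  (forall i j, smooth_on D (fun x => A x i j)) -> smooth_on D (fun x => \det (A x)).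
Proof.
move=> oD sA; apply: smooth_on_sum => // s _; apply: smooth_onM => //.
  exact: smooth_on_cst.
exact: smooth_on_prod.
Qed.

(** Cramer's rule. *)
Lemma smooth_on_invmx D m (A : 'rV[R]_n -> 'M[R]_m) : open D ->
  (forall x, D x -> A x \in unitmx) ->
  (forall i j, smooth_on D (fun x => A x i j)) ->
  forall i j, smooth_on D (fun x => invmx (A x) i j).
Proof.
move=> oD uA sA i j.
apply: (@smooth_on_ext _ (fun x => (\det (A x))^-1 * cofactor (A x) j i)) => //.
  by move=> x; rewrite inE /invmx => /uA ->; rewrite !mxE.
apply: smooth_onM => //.
  apply: smooth_onV => //; last exact: smooth_on_det.
  by move=> x /uA; rewrite unitmxE unitfE.
apply: smooth_onM => //; first exact: smooth_on_cst.
apply: smooth_on_det => // k l; under eq_fun do rewrite !mxE.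
exact: sA.
Qed.

End FiniteSmoothness.

(** * Chain rule, mean value theorem, symmetry of mixed derivatives *)

Section ChainRule.
Context {R : realType} {n : nat}.
Implicit Types (D : set 'rV[R]_n) (f h : 'rV[R]_n -> R).

Lemma is_derive_curve f (c : R -> 'rV[R]_n) t (v : 'rV[R]_n) :
  differentiable f (c t) ->
  (forall i, is_derive t 1 (fun s => c s 0 i) (v 0 i)) ->
  is_derive t 1 (fun s => f (c s)) (\sum_i v 0 i * partial i f (c t)).
Proof.
move=> df dc.
have derc : derivable c t 1.
  by apply/derivable_mxP => i j; rewrite ord1; case: (dc j).
have diffc : differentiable c t by apply/derivable1_diffP.
have -> : v = 'd c t 1.
  rewrite -deriveE// derive_mx//; apply/rowP => j; rewrite mxE.
  by case: (dc j) => _ <-.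
have dfc : differentiable (f \o c) t by exact: differentiable_comp.
apply: DeriveDef; first exact/derivable1_diffP.
by rewrite deriveE// diff_comp//= diff_partial.
Qed.

Lemma is_derive_line f y (v : 'rV[R]_n) (t : R) : differentiable f (y + t *: v) ->
  is_derive t 1 (fun s : R => f (y + s *: v)) (\sum_i v 0 i * partial i f (y + t *: v)).
Proof.
move=> df; apply: (is_derive_curve (c := fun s => y + s *: v)) => // i.
rewrite (_ : (fun s => _) = cst (y 0 i) + (fun s : R => s * v 0 i)); last first.
  by apply/funext => s; rewrite !mxE.
rewrite -[v 0 i]add0r; apply: is_deriveD; rewrite add0r.
rewrite (_ : (fun s : R => _) = v 0 i \*: id); last first.
  by apply/funext => s; rewrite mulrC.
by rewrite -[X in is_derive _ _ _ X]mulr1; exact: is_deriveZ.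
Qed.

Lemma MVT_line f y (v : 'rV[R]_n) :
  (forall s : R, 0 <= s <= 1 -> differentiable f (y + s *: v)) ->
  exists2 s : R, 0 <= s <= 1 &
    f (y + v) - f y = \sum_i v 0 i * partial i f (y + s *: v).
Proof.
move=> df.
have dg (s : R) : 0 <= s <= 1 -> is_derive s 1 (fun s : R => f (y + s *: v))
    (\sum_i v 0 i * partial i f (y + s *: v)).
  by move=> /df; exact: is_derive_line.
have [||s] := @MVT R (fun s : R => f (y + s *: v))
    (fun s => \sum_i v 0 i * partial i f (y + s *: v)) 0 1 ltr01.
- by move=> s; rewrite in_itv/= => /andP[s0 s1]; apply: dg; rewrite !ltW.
- apply: derivable_within_continuous => s; rewrite in_itv/= => s01.
  by have [] := dg s s01.
- rewrite in_itv/= => /andP[s0 s1]; rewrite scale1r scale0r addr0 subr0 mulr1 => ->.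
  by exists s => //; rewrite !ltW.
Qed.

Lemma differentiable_shift f (w : 'rV[R]_n) x :
  differentiable f (x + w) -> differentiable (fun z => f (z + w)) x.
Proof.
move=> df; apply: (@differentiable_comp _ _ _ _ (fun z => z + w) f) => //.
Qed.

Lemma partial_shift f (w : 'rV[R]_n) x i :
  partial i (fun z => f (z + w)) x = partial i f (x + w).
Proof.
rewrite /partial /derive.
suff -> : (fun h : R => h^-1 *: (((fun z => f (z + w)) \o shift x)
      (h *: delta_mx 0 i) - f (x + w))) =
    (fun h : R => h^-1 *: ((f \o shift (x + w)) (h *: delta_mx 0 i) - f (x + w)))
  by [].
by apply/funext => h /=; rewrite addrA.
Qed.

End ChainRule.

Section Schwarz.
Context {R : realType} {n : nat}.
Implicit Types (D : set 'rV[R]_n) (f h : 'rV[R]_n -> R).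

(** Two applications of the mean value theorem.  The left-hand side does not
   change when i and j are exchanged, which is the reason for the symmetry of
   the mixed derivatives. *)
Lemma second_difference f x (r t : R) i j :
  0 < t -> t * (`|delta_mx 0 i : 'rV[R]_n| + `|delta_mx 0 j : 'rV[R]_n|) < r ->
  (forall y, ball x r y -> differentiable f y /\ differentiable (partial i f) y) ->
  exists2 y, ball x r y &
    f (x + t *: delta_mx 0 i + t *: delta_mx 0 j) - f (x + t *: delta_mx 0 j)
      - (f (x + t *: delta_mx 0 i) - f x) = t ^+ 2 * partial j (partial i f) y.
Proof.
set u := delta_mx 0 i : 'rV[R]_n; set v := delta_mx 0 j : 'rV[R]_n.
move=> t0 tr df.
have B (s s' : R) : 0 <= s <= 1 -> 0 <= s' <= 1 ->
    ball x r (x + s *: (t *: u) + s' *: (t *: v)).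
  move=> s01 s'01; rewrite -ball_normE /= -addrA opprD addrA subrr sub0r.
  apply: le_lt_trans tr; rewrite normrN (le_trans (ler_normD _ _))//.
  rewrite mulrDr !normrZ (ger0_norm (ltW t0)).
  have /andP[s0 s1] := s01; have /andP[s'0 s'1] := s'01.
  by rewrite !ger0_norm// lerD// ler_piMl// mulr_ge0// ltW.
have E (w : 'rV[R]_n) k (h : 'rV[R]_n -> R) :
    \sum_l (t *: (delta_mx 0 k : 'rV[R]_n)) 0 l * partial l h w
    = t * partial k h w.
  rewrite (bigD1 k)//= big1 ?addr0 ?mxE ?eqxx ?mulr1// => l lk.
  by rewrite !mxE (negbTE lk) andbF mulr0 mul0r.
have i01 (s : R) : s = 0 \/ s = 1 -> 0 <= s <= 1.
  by case=> ->; rewrite lexx ler01.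
have i1 := i01 1 (or_intror erefl).
have i0 := i01 0 (or_introl erefl).
pose k z := f (z + t *: v) - f z.
have dk (s : R) : 0 <= s <= 1 -> differentiable (fun z => f (z + t *: v)) (x + s *: (t *: u))
    /\ differentiable f (x + s *: (t *: u)).
  move=> s01; split; last first.
    by have [] := df _ (B s 0 s01 i0); rewrite scale0r addr0.
  apply: differentiable_shift.
  by have [] := df _ (B s 1 s01 i1); rewrite scale1r.
have [s s01] := @MVT_line _ _ k x (t *: u) (fun s s01 =>
   differentiableB (dk s s01).1 (dk s s01).2).
rewrite {1 2}/k E//.
have -> : partial i k (x + s *: (t *: u)) =
    partial i f (x + s *: (t *: u) + t *: v) - partial i f (x + s *: (t *: u)).
  rewrite -(partial_shift _ (t *: v)) /partial.
  by rewrite [LHS]deriveB//; apply: diff_derivable; have [] := dk s s01.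
have [s' s'01 ->] := @MVT_line _ _ (partial i f) (x + s *: (t *: u)) (t *: v)
  (fun s' s'01 => (df _ (B s s' s01 s'01)).2).
rewrite E// mulrA -expr2 => fE.
by exists (x + s *: (t *: u) + s' *: (t *: v)); [exact: B|rewrite -fE; ring].
Qed.

(** The second difference over a small square is t^2 times either mixed
   derivative at nearby points; both are continuous at x. *)
Lemma partialC D f i j x : open D -> smooth_on D f -> D x ->
  partial i (partial j f) x = partial j (partial i f) x.
Proof.
move=> oD sf Dx.
have cont k l : {for x, continuous (partial k (partial l f))}.
  by apply: differentiable_continuous; exact: (sf [:: k; l]).
set A := LHS; set B := RHS; apply/eqP; apply/negPn/negP => AB.
pose e := `|A - B| / 2.
have e0 : 0 < e by rewrite divr_gt0// normr_gt0 subr_eq0.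
have nA : \forall y \near x, `|A - partial i (partial j f) y| < e.
  by move/cvgrPdist_lt : (cont i j); apply.
have nB : \forall y \near x, `|B - partial j (partial i f) y| < e.
  by move/cvgrPdist_lt : (cont j i); apply.
have : \forall y \near x, [/\ D y, `|A - partial i (partial j f) y| < e &
    `|B - partial j (partial i f) y| < e].
  have nD : \forall y \near x, D y by exact: open_nbhs_nbhs.
  exact: filterS3 nD nA nB.
move=> /nbhs_ballP[r /= r0 rP].
pose m := `|delta_mx 0 i : 'rV[R]_n| + `|delta_mx 0 j : 'rV[R]_n|.
have m0 : 0 <= m by rewrite addr_ge0.
pose t := r / (m + 1).
have m10 : 0 < m + 1 by rewrite ltr_wpDl.
have t0 : 0 < t by rewrite divr_gt0.
have tm : t * m < r.
  by rewrite /t -mulrA gtr_pMr// mulrC ltr_pdivrMr// mul1r ltrDl.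
have df k y : ball x r y -> differentiable f y /\ differentiable (partial k f) y.
  by move=> /rP[Dy _ _]; split; [exact: (sf [::])|exact: (sf [:: k])].
have [y yr yE] := second_difference t0 tm (df i).
have tm' : t * (`|delta_mx 0 j : 'rV[R]_n| + `|delta_mx 0 i : 'rV[R]_n|) < r.
  by rewrite addrC.
have [z zr zE] := second_difference t0 tm' (df j).
have [_ _ yB] := rP _ yr; have [_ zA _] := rP _ zr.
have yz : partial i (partial j f) z = partial j (partial i f) y.
  have t20 : t ^+ 2 != 0 by rewrite expf_neq0// gt_eqF.
  move: yE zE; move: (partial j _ _) (partial i _ _) => P Q.
  rewrite (addrAC x); move: (f _) (f _) (f _) (f x) => a b c d aP aQ.
  by apply: (mulfI t20); rewrite -aP -aQ; ring.
move: zA; rewrite yz => zA.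
have : `|A - B| < e + e.
  move: (partial j _ y) zA yB => P zA yB; rewrite -[A - B](subrKA P).
  apply: le_lt_trans (ler_normD _ _) _; apply: ltrD; first exact: zA.
  by rewrite distrC; exact: yB.
by rewrite /e -splitr ltxx.
Qed.

End Schwarz.

(** * Existence for Lipschitz differential equations *)

Section Picard.
Context {R : realType}.
Local Notation mu := (@lebesgue_measure R).

Lemma continuous_dominated (I : finType) (h : R -> R) (u : R -> I -> R) (K : R) t :
  0 <= K -> (forall j, {for t, continuous (fun s => u s j)}) ->
  (forall s, `|h t - h s| <= K * \sum_j `|u t j - u s j|) ->
  {for t, continuous h}.
Proof.
move=> K0 cu hK; apply/cvgrPdist_lt => e e0.
pose d := e / (K * #|I|%:R + 1).
have K1 : 0 < K * #|I|%:R + 1 by rewrite ltr_wpDl// mulr_ge0.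
have d0 : 0 < d by rewrite divr_gt0.
have : \forall s \near t, forall j, `|u t j - u s j| < d.
  apply: (@filter_forall _ _ (fun j s => `|u t j - u s j| < d) (nbhs t) _) => j.
  by move/cvgrPdist_lt: (cu j) => /(_ _ d0).
apply: filterS => s us; rewrite (le_lt_trans (hK s))//.
apply: (@le_lt_trans _ _ (K * (#|I|%:R * d))).
  rewrite ler_wpM2l// mulr_natl -sumr_const ler_sum// => j _; exact: ltW.
by rewrite mulrA mulrCA gtr_pMr// ltr_pdivrMr// mul1r ltrDl.
Qed.

(** The integral starts at -2, to have an open interval around [-1, 1]. *)
Definition antideriv (f : R -> R) (t : R) : R :=
  (\int[mu]_(s in `[(-2), t]) f s - \int[mu]_(s in `[(-2), 0%R]) f s)%R.

Lemma is_derive_antideriv (f : R -> R) (t : R) : continuous f -> t \in `]-2, 2[ ->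
  is_derive t 1 (antideriv f) (f t).
Proof.
rewrite in_itv/= => cf /andP[t2 t2'].
have fi : mu.-integrable `[(-2), 2] (EFin \o f).
  apply: continuous_compact_integrable; first exact: segment_compact.
  exact: continuous_subspaceT.
have [d1 d2] := continuous_FTC1_closed t2' fi t2 (cf t).
rewrite /antideriv.
rewrite -[f t]subr0 -d2 derive1E.
apply: (@is_deriveB _ _ _ _ (cst _)); exact: derivableP.
Qed.

Variable delta : R.
Hypotheses (delta0 : 0 < delta) (delta1 : delta <= 1).

(** For r >= 0, the point of [c - r, c + r] closest to t. *)
Definition clamp (c r t : R) : R := Num.max (c - r) (Num.min (c + r) t).

Lemma clamp_id (c r t : R) : `|t - c| <= r -> clamp c r t = t.
Proof.
rewrite ler_distl => /andP[t1 t2].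
by rewrite /clamp (min_idPr t2) (max_idPr t1).
Qed.

Lemma clamp_dist (c r t : R) : 0 <= r -> `|clamp c r t - c| <= r.
Proof.
move=> r0; rewrite ler_distl /clamp ge_max le_max lexx/= ge_min lexx.
by rewrite andbT; lra.
Qed.

Lemma clamp_lip (c r s t : R) : `|clamp c r s - clamp c r t| <= `|s - t|.
Proof.
rewrite /clamp !maxEle !minEle.
case: (leP (c + r) s) => h1; case: (leP (c + r) t) => h2;
repeat (case: ifPn; rewrite -?ltNge => ?);
rewrite ?subrr ?normr0 ?normr_ge0// ler_norml;
have := ler_norm (s - t); have := ler_norm (t - s); rewrite (distrC t); lra.
Qed.

(** Clamping the time makes the integral of a continuous function continuous
   on the whole line, so that it can be iterated, and does not affect its
   derivative for small times. *)
Definition volterra (f : R -> R) (t : R) := antideriv f (clamp 0 delta t).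

Lemma clamp_itv t : clamp 0 delta t \in `](-2 : R), 2[.
Proof.
have := clamp_dist 0 t (ltW delta0); rewrite subr0 ler_norml in_itv/=.
by have := delta1; move=> ? /andP[? ?]; apply/andP; split; lra.
Qed.

Lemma volterra0 f : volterra f 0 = 0.
Proof. by rewrite /volterra clamp_id ?subrr ?normr0 ?ltW// /antideriv subrr. Qed.

Lemma volterra_continuous (f : R -> R) : continuous f -> continuous (volterra f).
Proof.
move=> cf t.
apply: (@continuous_comp _ _ _ (clamp 0 delta) (antideriv f)); last first.
  apply: differentiable_continuous; apply/derivable1_diffP.
  by have [] := is_derive_antideriv cf (clamp_itv t).
apply: (@continuous_dominated unit _ (fun s _ => s) 1) => [//|_|s].
  exact: cvg_id.
by rewrite mul1r sumr_const card_unit mulr1n; exact: clamp_lip.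
Qed.

Lemma is_derive_volterra (f : R -> R) (t : R) : continuous f -> `|t| < delta ->
  is_derive t 1 (volterra f) (f t).
Proof.
move=> cf td.
have tI : t \in `](-2 : R), 2[.
  by have := clamp_itv t; rewrite clamp_id// subr0 ltW.
apply: near_eq_is_derive (is_derive_antideriv cf tI).
have : \forall s \near t, `|s| < delta.
  have := @norm_continuous _ R t.
  by move=> /cvgr_lt; apply.
by apply: filterS => s sd; rewrite /volterra clamp_id// subr0 ltW.
Qed.

Lemma volterra_dist (f h : R -> R) (M t : R) : continuous f -> continuous h ->
  (forall s, `|f s - h s| <= M) -> `|volterra f t - volterra h t| <= M * delta.
Proof.
move=> cf ch fM; rewrite /volterra; set c := clamp 0 delta t.
have cd : `|c| <= delta by rewrite -[c]subr0 clamp_dist// ltW.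
pose k (s : R) : R := antideriv f s - antideriv h s.
have dk (s : R) : `|s| <= delta -> is_derive s 1 k (f s - h s).
  move=> sd; have sI : s \in `](-2 : R), 2[.
    by have := clamp_itv s; rewrite clamp_id// subr0.
  by apply: (@is_deriveB _ _ _ (antideriv f) (antideriv h)); exact: is_derive_antideriv.
have k0 : k 0 = 0 by rewrite /k /antideriv !subrr.
rewrite -[X in `|X|]/(k c).
have M0 : 0 <= M by exact: le_trans (fM 0).
have [c0|c0] := leP 0 c.
  rewrite ger0_norm// in cd.
  have [||s] := @MVT_segment R k (fun s => f s - h s) 0 c c0.
  - move=> s; rewrite in_itv/= => /andP[/ltW s0 /ltW sc]; apply: dk.
    by rewrite ger0_norm//; exact: le_trans sc cd.
  - apply: derivable_within_continuous => s; rewrite in_itv/= => /andP[s0 sc].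
    have sd : `|s| <= delta by rewrite ger0_norm//; exact: le_trans sc cd.
    by have [] := dk s sd.
  - move=> _; rewrite k0 !subr0 => ->; rewrite normrM (ger0_norm c0).
    exact: ler_pM.
rewrite ltr0_norm// in cd.
have sd (s : R) : c <= s -> s <= 0 -> `|s| <= delta.
  by move=> cs s0; rewrite ler0_norm// (le_trans _ cd)// lerN2.
have [||s] := @MVT_segment R k (fun s => f s - h s) c 0 (ltW c0).
- by move=> s; rewrite in_itv/= => /andP[/ltW cs /ltW s0]; exact/dk/sd.
- apply: derivable_within_continuous => s; rewrite in_itv/= => /andP[cs s0].
  by have [] := dk s (sd s cs s0).
- move=> _; rewrite k0 !sub0r => /eqP; rewrite eqr_oppLR => /eqP ->.
  rewrite normrN normrM (gtr0_norm (x := - c)) ?oppr_gt0//.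
  by apply: ler_pM => //; rewrite oppr_ge0 ltW.
Qed.

End Picard.

(** The time delta is chosen such that the integral operator contracts
   distances by 1/2.  The Lipschitz condition is global, so that the range of
   the iterates needs no control. *)
Theorem picard (R : realType) (I : finType) (F : (I -> R) -> I -> R) (L : R)
    (x0 : I -> R) : 0 <= L ->
  (forall x y i, `|F x i - F y i| <= L * \sum_j `|x j - y j|) ->
  exists2 delta : R, 0 < delta & exists x : R -> I -> R,
    (forall i, x 0 i = x0 i) /\
    forall (t : R) i, `|t| < delta -> is_derive t 1 (fun s => x s i) (F (x t) i).
Proof.
move=> L0 FL.
pose m : R := #|I|%:R.
have m0 : 0 <= m by [].
pose delta : R := (2 * L * m + 1)^-1.
have D0 : 0 < 2 * L * m + 1 by rewrite ltr_wpDl// mulr_ge0// mulr_ge0.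
have delta0 : 0 < delta by rewrite invr_gt0.
have delta1 : delta <= 1.
  by rewrite invf_le1// lerDr mulr_ge0// mulr_ge0.
have deltaL : L * m * delta <= 2^-1.
  rewrite /delta ler_pdivrMr//; lra.
exists delta => //.
pose u := fix u k t i : R := if k is k'.+1 then
  x0 i + volterra delta (fun s => F (u k' s) i) t else x0 i.
have FcontE (x : R -> I -> R) i : (forall j, continuous (fun s => x s j)) ->
    continuous (fun s => F (x s) i).
  move=> cx t; apply: (@continuous_dominated _ I _ x L) => //.
  by move=> j; exact: cx.
have cu k i : continuous (fun s => u k s i).
  elim: k i => [|k IH] i t; first exact: cst_continuous.
  apply: (@continuousD _ _ _ (cst (x0 i))); first exact: cst_continuous.
  by apply: volterra_continuous => //; exact: FcontE.
have step (x y : R -> I -> R) M i t : (forall j, continuous (fun s => x s j)) ->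
    (forall j, continuous (fun s => y s j)) ->
    (forall s j, `|x s j - y s j| <= M) ->
    `|(x0 i + volterra delta (fun s => F (x s) i) t) -
      (x0 i + volterra delta (fun s => F (y s) i) t)| <= M / 2.
  move=> cx cy xM; rewrite opprD addrACA subrr add0r.
  have M0 : 0 <= M by exact: le_trans (xM 0 i).
  apply: (@le_trans _ _ (L * (m * M) * delta)).
    apply: volterra_dist => //; [exact: FcontE|exact: FcontE|move=> s].
    apply: le_trans (FL _ _ _) _; rewrite ler_wpM2l//.
    by rewrite mulr_natl -sumr_const ler_sum.
  by rewrite mulrA mulrAC [leRHS]mulrC ler_wpM2r.
pose C : R := \sum_i `|F x0 i|.
have C0 : 0 <= C by rewrite sumr_ge0.
pose b k : R := C / 2 ^+ k.
have b0 k : 0 <= b k by rewrite divr_ge0// exprn_ge0.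
have bS k : b k.+1 = b k / 2 by rewrite /b exprSr invfM mulrA.
have uS k : forall t i, `|u k.+1 t i - u k t i| <= b k.
  elim: k => [|k IH] t i; last by rewrite bS; apply: (step (u k.+1) (u k)).
  have z0 : volterra delta (cst 0) t = 0.
    by rewrite /volterra /antideriv !Rintegral_cst// !mul0r subrr.
  rewrite /b expr0 divr1 /= addrC addKr -[X in `|X|]subr0 -z0.
  apply: (@le_trans _ _ (C * delta)); last by rewrite ler_piMr.
  apply: volterra_dist => //; [exact: cst_continuous|exact: cst_continuous|].
  by move=> s; rewrite /cst subr0 /C (bigD1 i)//= lerDl sumr_ge0.
(* The lower bounds u k - 2 b k increase and the upper bounds u k + 2 b k
   decrease, so the limit is the supremum of the former. *)
have lo t i : {homo (fun k => u k t i - 2 * b k) : k l / (k <= l)%N >-> k <= l}.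
  apply: homo_leq => [//|y x z|k]; first exact: le_trans.
  by have := uS k t i; rewrite ler_distl bS => /andP[]; have := b0 k; lra.
have hi t i : {homo (fun k => u k t i + 2 * b k) : k l / (k <= l)%N >-> l <= k}.
  apply: homo_leq => [//|y x z yx zy|k]; first exact: le_trans zy yx.
  by have := uS k t i; rewrite ler_distl bS => /andP[]; have := b0 k; lra.
have lohi t i k l : u k t i - 2 * b k <= u l t i + 2 * b l.
  apply: le_trans (lo t i _ _ (leq_maxl k l)) _.
  apply: le_trans (hi t i _ _ (leq_maxr k l)).
  by have := b0 (maxn k l); lra.
pose x t i := sup [set u k t i - 2 * b k | k in setT].
have xu t i k : `|x t i - u k t i| <= 2 * b k.
  rewrite ler_distl; apply/andP; split.
    apply: sup_upper_bound; last by exists k.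
    split; first by exists (u 0%N t i - 2 * b 0%N); exists 0%N.
    by exists (u 0%N t i + 2 * b 0%N) => _ [l _ <-].
  apply: ge_sup; first by exists (u 0%N t i - 2 * b 0%N); exists 0%N.
  by move=> _ [l _ <-].
have small e : 0 < e -> exists k, b k < e.
  move=> e0; have half1 : `|2^-1 : R| < 1.
    by rewrite ger0_norm ?invr_ge0// invf_lt1// ltr1n.
  have /cvgrPdist_lt/(_ e e0)[N _ HN] := cvg_geometric C half1.
  exists N; have := HN N (leqnn N).
  by rewrite /= sub0r normrN /geometric/= exprVn ger0_norm// b0.
have cx i : continuous (fun s => x s i).
  move=> t; apply/cvgrPdist_lt => e e0.
  have [|k bk] := small (e / 8); first by rewrite divr_gt0.
  have : \forall s \near t, `|u k t i - u k s i| < e / 8.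
    by move/cvgrPdist_lt : (cu k i t) => /(_ (e / 8)); apply; rewrite divr_gt0.
  apply: filterS => s us.
  have := xu t i k; have := xu s i k.
  rewrite !ler_distl => /andP[? ?] /andP[? ?].
  move: us; rewrite !ltr_distl => /andP[? ?]; apply/andP; split; lra.
have xE t i : x t i = x0 i + volterra delta (fun s => F (x s) i) t.
  apply/eqP; rewrite -subr_eq0 -normr_le0; apply/ler_addgt0Pr => e e0.
  rewrite add0r.
  have [|k bk] := small (e / 8); first by rewrite divr_gt0.
  have h1 := xu t i k.+1.
  have h2 : `|u k.+1 t i - (x0 i + volterra delta (fun s => F (x s) i) t)|
      <= 2 * b k / 2.
    by apply: step => // s j; rewrite distrC.
  rewrite -(subrKA (u k.+1 t i)); apply: le_trans (ler_normD _ _) _.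
  rewrite bS in h1; move: h1 h2; have := b0 k; lra.
exists x; split=> [i|t i td]; first by rewrite xE volterra0// addr0.
rewrite (_ : (fun s => x s i) =
    cst (x0 i) + volterra delta (fun s => F (x s) i)); last first.
  by apply/funext => s; rewrite xE.
rewrite -[F (x t) i]add0r; apply: is_deriveD.
apply: (is_derive_volterra delta0 delta1 _ td).
exact: FcontE.
Qed.

(** * Unique continuation for total linear systems *)

Section UniqueContinuation.
Context {R : realType} {n : nat}.

(** The function phi exp (- C s) does not increase. *)
Lemma gronwall_zero (phi dphi : R -> R) (C : R) :
  (forall s : R, 0 <= s <= 1 -> is_derive s 1 phi (dphi s)) ->
  (forall s : R, 0 <= s <= 1 -> dphi s <= C * phi s) -> phi 0 <= 0 -> phi 1 <= 0.
Proof.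
move=> dphiE dphi_le phi0.
pose psi s := phi s * expR (- C * s).
have dpsi (s : R) : 0 <= s <= 1 ->
    is_derive s 1 psi ((dphi s - C * phi s) * expR (- C * s)).
  move=> s01; have ds := dphiE s s01.
  have de : is_derive s 1 (fun s => expR (- C * s)) (- C * expR (- C * s)).
    have dl : is_derive s 1 (fun s : R => - C * s) (- C).
      by rewrite -[X in is_derive _ _ _ X]mulr1; exact: is_deriveZ.
    rewrite mulrC.
    exact: (@is_derive1_comp _ expR (fun s : R => - C * s) s _ _ (is_derive_expR _) dl).
  apply: is_derive_eq (is_deriveM ds de) _.
  by rewrite /GRing.scale/=; ring.
have : psi 1 <= psi 0.
  apply: (@ler0_derive1_le_cc _ psi 0 1) => //; rewrite ?in_itv/= ?lexx ?ler01//.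
  - move=> s; rewrite in_itv/= => /andP[s0 s1].
    by have [] := dpsi s; rewrite ?ltW.
  - move=> s; rewrite in_itv/= => /andP[s0 s1].
    have s01 : 0 <= s <= 1 by rewrite !ltW.
    rewrite derive1E; have [_ ->] := dpsi s s01.
    by rewrite mulr_le0_ge0 ?expR_ge0// subr_le0 dphi_le.
  - apply: derivable_within_continuous => s; rewrite in_itv/= => s01.
    by have [] := dpsi s s01.
rewrite /psi mulr0 expR0 mulr1 => /le_trans/(_ phi0).
by rewrite pmulr_lle0// expR_gt0.
Qed.

(** Sum the inequalities 2 |a| |b| <= a^2 + b^2. *)
Lemma sum_sqr_le (I : finType) (f : I -> R) :
  (\sum_k `|f k|) ^+ 2 <= #|I|%:R * \sum_k f k ^+ 2.
Proof.
rewrite expr2 big_distrlr/=.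
apply: (@le_trans _ _ (\sum_i \sum_j (f i ^+ 2 + f j ^+ 2) / 2)).
  apply: ler_sum => i _; apply: ler_sum => j _.
  rewrite ler_pdivlMr// -(real_normK (num_real (f i))) -(real_normK (num_real (f j))).
  have := sqr_ge0 (`|f i| - `|f j|); lra.
set S := \sum_k f k ^+ 2.
have E i : \sum_j (f i ^+ 2 + f j ^+ 2) / 2 = (#|I|%:R * f i ^+ 2 + S) / 2.
  by rewrite -mulr_suml big_split/= sumr_const -[_ ^+ 2 *+ _]mulr_natl.
rewrite (eq_bigr _ (fun i _ => E i)) -mulr_suml big_split/= -mulr_sumr sumr_const.
rewrite -[S *+ _]mulr_natl -/S; lra.
Qed.

(** Apply Gronwall to the sum of the squares of the f k, along the segment
   from x0 to x. *)
Lemma unique_continuation_ball (I : finType) (f : I -> 'rV[R]_n -> R)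
    (x0 : 'rV[R]_n) (r K : R) : 0 <= K ->
  (forall k x, ball x0 r x -> differentiable (f k) x) ->
  (forall i k x, ball x0 r x -> `|partial i (f k) x| <= K * \sum_l `|f l x|) ->
  (forall k, f k x0 = 0) -> forall k x, ball x0 r x -> f k x = 0.
Proof.
move=> K0 df fK f0 k0 x xr.
pose v := x - x0.
have line (s : R) : 0 <= s <= 1 -> ball x0 r (x0 + s *: v).
  move=> /andP[s0 s1]; move: xr; rewrite -!ball_normE/= opprD addrA subrr sub0r.
  rewrite normrN normrZ ger0_norm// distrC; apply: le_lt_trans.
  by rewrite ler_piMl.
pose phi (s : R) := \sum_k f k (x0 + s *: v) ^+ 2.
pose df' k (s : R) := \sum_i v 0 i * partial i (f k) (x0 + s *: v).
pose dphi (s : R) := \sum_k 2 * f k (x0 + s *: v) * df' k s.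
pose V := \sum_i `|v 0 i|.
have V0 : 0 <= V by rewrite sumr_ge0.
have phi1 : phi 1 <= 0.
  apply: (@gronwall_zero phi dphi (2 * (V * K * #|I|%:R))).
  - move=> s s01.
    have -> : phi = \sum_k (fun s => f k (x0 + s *: v)) * (fun s => f k (x0 + s *: v)).
      by apply/funext => t; rewrite fct_sumE; apply: eq_bigr => k _; rewrite expr2.
    have d k : is_derive s 1
        ((fun s => f k (x0 + s *: v)) * (fun s => f k (x0 + s *: v)))
        (2 * f k (x0 + s *: v) * df' k s).
      have dk := is_derive_line (df k _ (line s s01)).
      apply: is_derive_eq (is_deriveM dk dk) _.
      by rewrite /GRing.scale/= -/(df' k s); ring.
    rewrite /dphi; elim/big_ind2 : _ => //; last by move=> ? ? ? ? ? ?; apply: is_deriveD.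
    exact: is_derive_cst.
  - move=> s s01; rewrite -mulrA; set S := \sum_l `|f l (x0 + s *: v)|.
    have S0 : 0 <= S by rewrite sumr_ge0.
    apply: (@le_trans _ _ (\sum_k 2 * `|f k (x0 + s *: v)| * (V * (K * S)))).
      apply: ler_sum => k _; rewrite -!mulrA ler_pM2l//.
      apply: le_trans (ler_norm _) _; rewrite normrM ler_wpM2l//.
      apply: le_trans (ler_norm_sum _ _ _) _; rewrite /V mulr_suml.
      apply: ler_sum => i _; rewrite normrM ler_wpM2l//.
      exact/fK/line.
    rewrite -mulr_suml -mulr_sumr -!mulrA ler_pM2l//.
    rewrite (_ : _ * _ = V * K * S ^+ 2); last by rewrite -/S; ring.
    rewrite -mulrA ler_wpM2l// ler_wpM2l//.
    exact: sum_sqr_le.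
  - by rewrite /phi scale0r addr0 big1// => k _; rewrite f0 expr0n.
have phi_ge0 k : 0 <= f k (x0 + 1 *: v) ^+ 2 by exact: sqr_ge0.
have : f k0 (x0 + 1 *: v) ^+ 2 <= 0.
  by apply: le_trans phi1; rewrite /phi (bigD1 k0)//= lerDl sumr_ge0.
rewrite scale1r /v addrC subrK => f2; apply/eqP; rewrite -sqrf_eq0.
by rewrite eq_le f2 sqr_ge0.
Qed.

(** Near x0 the coefficients are bounded, since they are continuous. *)
Lemma unique_continuation (I : finType) (f : I -> 'rV[R]_n -> R)
    (A : 'I_n -> I -> I -> 'rV[R]_n -> R) (x0 : 'rV[R]_n) :
  (\forall x \near x0, forall k, differentiable (f k) x) ->
  (forall i k l, {for x0, continuous (A i k l)}) ->
  (\forall x \near x0, forall i k,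
     partial i (f k) x = \sum_l A i k l x * f l x) ->
  (forall k, f k x0 = 0) -> \forall x \near x0, forall k, f k x = 0.
Proof.
move=> ndf cA npf f0.
pose K := \sum_i \sum_k \sum_l (`|A i k l x0| + 1).
have Aterm i k l : `|A i k l x0| + 1 <= K.
  rewrite /K (bigD1 i)//= (bigD1 k)//= (bigD1 l)//= -!addrA lerD2l lerDl.
  by rewrite !addr_ge0// sumr_ge0// => *; rewrite ?sumr_ge0// => *;
    rewrite ?sumr_ge0// => *; rewrite addr_ge0.
have K0 : 0 <= K.
  by rewrite sumr_ge0// => *; rewrite sumr_ge0// => *; rewrite sumr_ge0// => *;
    rewrite addr_ge0.
have nA : \forall x \near x0, forall t : 'I_n * (I * I),
    `|A t.1 t.2.1 t.2.2 x| <= K.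
  apply: (@filter_forall _ _ (fun (t : 'I_n * (I * I)) x =>
    `|A t.1 t.2.1 t.2.2 x| <= K) (nbhs x0) _) => -[i [k l]] /=.
  move/cvgrPdist_lt : (cA i k l) => /(_ _ ltr01); apply: filterS => x Ax.
  apply: le_trans (Aterm i k l).
  rewrite -lerBlDl (le_trans (lerB_dist _ _))// distrC; exact: ltW.
have : \forall x \near x0, [/\ forall k, differentiable (f k) x,
    forall t : 'I_n * (I * I), `|A t.1 t.2.1 t.2.2 x| <= K &
    forall i k, partial i (f k) x = \sum_l A i k l x * f l x].
  exact: filterS3 ndf nA npf.
move=> /nbhs_ballP[r /= r0 rP]; apply/nbhs_ballP; exists r => //= x xr k.
apply: (@unique_continuation_ball I f x0 r K) => //.
  by move=> l y /rP[].
move=> i l y /rP[_ AK ->]; rewrite mulr_sumr.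
apply: le_trans (ler_norm_sum _ _ _) _; apply: ler_sum => j _.
by rewrite normrM ler_wpM2r//; exact: (AK (i, (l, j))).
Qed.

End UniqueContinuation.

(** * Smooth curves and bounded Lipschitz functions *)

Section CurveSmoothness.
Context {R : realType}.
Implicit Types (J : set R) (h u : R -> R).

Fixpoint csmooth k J h : Prop :=
  if k is k'.+1 then
    (forall t : R, J t -> derivable h t 1) /\ csmooth k' J (derive1 h)
  else True.

Lemma csmooth_derivable k J h t : csmooth k.+1 J h -> J t ->
  derivable (derive1n k h) t 1.
Proof.
elim: k h => [|k IH] h; first by case=> + _; apply.
by rewrite derive1Sn => -[_ ch]; apply: IH.
Qed.

Lemma csmoothW k J h : csmooth k.+1 J h -> csmooth k J h.
Proof. by elim: k h => [//|k IH] h [dh sh]; split=> //; exact: IH. Qed.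

Lemma csmoothS k J J' h : J' `<=` J -> csmooth k J h -> csmooth k J' h.
Proof.
by move=> JJ; elim: k h => [//|k IH] h [dh sh]; split=> [t /JJ/dh//|]; exact: IH.
Qed.

Lemma csmooth_ext k J h u : open J -> (forall t, J t -> h t = u t) ->
  csmooth k J h -> csmooth k J u.
Proof.
move=> oJ; elim: k h u => [//|k IH] h u hu [dh sh].
have nhu t : J t -> \forall s \near t, h s = u s.
  move=> Jt; have := open_nbhs_nbhs (conj oJ Jt).
  by apply: filterS => s Js; exact: hu.
split=> [t Jt|]; first exact: near_eq_derivable (nhu t Jt) (dh t Jt).
apply: IH sh => t Jt; rewrite !derive1E; exact/near_eq_derive/nhu.
Qed.

Lemma csmooth_cst k J (c : R) : csmooth k J (cst c).
Proof.
elim: k c => [//|k IH] c; split=> [t _|]; first exact: derivable_cst.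
by rewrite (_ : derive1 _ = cst 0) //; apply/funext => t; rewrite derive1_cst.
Qed.

Lemma csmoothD k J h u : open J -> csmooth k J h -> csmooth k J u ->
  csmooth k J (fun t => h t + u t).
Proof.
move=> oJ; elim: k h u => [//|k IH] h u [dh sh] [du su].
split=> [t Jt|]; first by apply: derivableD; [exact: dh|exact: du].
apply: (csmooth_ext oJ _ (IH _ _ sh su)) => t Jt.
by rewrite !derive1E [RHS]deriveD//; [exact: dh|exact: du].
Qed.

Lemma csmoothM k J h u : open J -> csmooth k J h -> csmooth k J u ->
  csmooth k J (fun t => h t * u t).
Proof.
move=> oJ; elim: k h u => [//|k IH] h u Sh Su.
have [[dh sh] [du su]] := (Sh, Su).
split=> [t Jt|]; first by apply: derivableM; [exact: dh|exact: du].
apply: (csmooth_ext oJ _ (csmoothD oJ (IH _ _ (csmoothW Sh) su)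
  (IH _ _ (csmoothW Su) sh))) => t Jt.
by rewrite !derive1E [RHS]deriveM//; [exact: dh|exact: du].
Qed.

Lemma csmooth_sum k J I (r : seq I) (P : pred I) (F : I -> R -> R) :
  open J -> (forall i, P i -> csmooth k J (F i)) ->
  csmooth k J (fun t => \sum_(i <- r | P i) F i t).
Proof.
move=> oJ sF; elim: r => [|j r IH].
  by under eq_fun do rewrite big_nil; exact: csmooth_cst.
case Pj: (P j); last by under eq_fun do rewrite big_cons Pj.
by under eq_fun do rewrite big_cons Pj; apply: csmoothD => //; exact: sF.
Qed.

Lemma csmooth_comp n k J (D : set 'rV[R]_n) f (c : R -> 'rV[R]_n) : open J ->
  (forall t, J t -> D (c t)) -> smoothk k D f ->
  (forall i, csmooth k J (fun t => c t 0 i)) -> csmooth k J (fun t => f (c t)).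
Proof.
move=> oJ JD; elim: k f => [//|k IH] f [df sf] sc.
have dfc (t : R) : J t -> is_derive t 1 (fun t => f (c t))
    (\sum_i derive1 (fun t => c t 0 i) t * partial i f (c t)).
  move=> Jt; have dct i : is_derive t 1 (fun t => c t 0 i)
      ((\row_i derive1 (fun t => c t 0 i) t) 0 i).
    by rewrite mxE derive1E; apply: derivableP; have [+ _] := sc i; exact.
  have := is_derive_curve (df _ (JD _ Jt)) dct.
  by under eq_bigr do rewrite mxE.
split=> [t /dfc[]//|].
apply: (@csmooth_ext _ _ (fun t =>
    \sum_i derive1 (fun t => c t 0 i) t * partial i f (c t))) => //.
  by move=> t /dfc[_ <-]; rewrite derive1E.
apply: csmooth_sum => // i _; apply: csmoothM => //; first by have [] := sc i.
by apply: IH; [exact: sf|move=> j; exact/csmoothW/sc].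
Qed.

End CurveSmoothness.

Section LocalFlow.
Context {R : realType}.

(** Bounded Lipschitz functions on R^I: boundedness makes the class closed
   under products. *)
Definition blip (I : finType) (f : (I -> R) -> R) := exists2 K : R, 0 <= K &
  forall x y, `|f x| <= K /\ `|f x - f y| <= K * \sum_j `|x j - y j|.

Lemma blip_clamp (I : finType) (i : I) c r : 0 <= r ->
  blip (fun x : I -> R => clamp c r (x i)).
Proof.
move=> r0; exists (1 + (`|c| + r)); first by rewrite !addr_ge0.
move=> x y; split.
  rewrite -[clamp _ _ _](subrK c) (le_trans (ler_normD _ _))//.
  by rewrite addrC [leRHS]addrC -addrA lerD2l ler_wpDr// clamp_dist.
rewrite (le_trans (clamp_lip _ _ _ _))//.
have S0 : `|x i - y i| <= \sum_j `|x j - y j|.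
  by rewrite (bigD1 i)//= lerDl sumr_ge0.
by rewrite mulrDl mul1r (le_trans S0)// lerDl mulr_ge0 ?addr_ge0// sumr_ge0.
Qed.

Lemma blipD (I : finType) (f h : (I -> R) -> R) : blip f -> blip h ->
  blip (fun x => f x + h x).
Proof.
move=> [K K0 fK] [L L0 hL]; exists (K + L); first exact: addr_ge0.
move=> x y; have [f1 f2] := fK x y; have [h1 h2] := hL x y; split.
  by rewrite (le_trans (ler_normD _ _))// lerD.
by rewrite opprD addrACA mulrDl (le_trans (ler_normD _ _))// lerD.
Qed.

Lemma blipM (I : finType) (f h : (I -> R) -> R) : blip f -> blip h ->
  blip (fun x => f x * h x).
Proof.
move=> [K K0 fK] [L L0 hL]; exists (K * L + K * L).
  by rewrite addr_ge0// mulr_ge0.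
move=> x y; have [f1 f2] := fK x y; have [h1 h2] := hL x y.
have [h3 _] := hL y x; split.
  by rewrite normrM (le_trans (ler_pM _ _ f1 h1))// lerDl mulr_ge0.
have -> : f x * h x - f y * h y = f x * (h x - h y) + (f x - f y) * h y by ring.
rewrite (le_trans (ler_normD _ _))// [leRHS]mulrDl !normrM lerD//.
  by rewrite -mulrA ler_pM.
by rewrite mulrAC; rewrite ler_pM.
Qed.

Lemma blip_cst (I : finType) (c : R) : blip (fun _ : I -> R => c).
Proof.
exists `|c| => // x y; split=> //.
by rewrite subrr normr0 mulr_ge0// sumr_ge0.
Qed.

Lemma blip_sum (I : finType) (A : Type) (r : seq A) (f : A -> (I -> R) -> R) :
  (forall a, blip (f a)) -> blip (fun x => \sum_(a <- r) f a x).
Proof.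
move=> bf; elim: r => [|a r IH].
  by under eq_fun do rewrite big_nil; exact: blip_cst.
by under eq_fun do rewrite big_cons; exact: blipD.
Qed.

Lemma rV_norm_le n (v : 'rV[R]_n) (r : R) : 0 <= r ->
  (forall i, `|v 0 i| <= r) -> `|v| <= r.
Proof.
move=> r0 vr; rewrite /Num.Def.normr/= mx_normrE bigmax_le// => -[i j] _ /=.
by rewrite ord1.
Qed.

Definition clamp_row n (I : finType) (e : 'I_n -> I) (x0 : 'rV[R]_n) (r : R)
  (x : I -> R) : 'rV[R]_n := \row_i clamp (x0 0 i) r (x (e i)).

Lemma clamp_row_ball n (I : finType) (e : 'I_n -> I) (x0 : 'rV[R]_n) (r : R) x :
  0 <= r -> `|clamp_row e x0 r x - x0| <= r.
Proof.
by move=> r0; apply: rV_norm_le => // i; rewrite !mxE; exact: clamp_dist.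
Qed.

Lemma ball_segment n (x0 a b : 'rV[R]_n) (r s : R) : 0 <= s <= 1 ->
  `|a - x0| <= r -> `|b - x0| <= r -> `|a + s *: (b - a) - x0| <= r.
Proof.
move=> /andP[s0 s1] ar br.
have -> : a + s *: (b - a) - x0 = (1 - s) *: (a - x0) + s *: (b - x0).
  by apply/rowP => i; rewrite !mxE; ring.
rewrite (le_trans (ler_normD _ _))// !normrZ (ger0_norm s0) ger0_norm ?subr_ge0//.
have -> : r = (1 - s) * r + s * r by ring.
by rewrite lerD// ler_wpM2l// subr_ge0.
Qed.

Lemma ler_sum_inj (I J : finType) (e : I -> J) (F : J -> R) : injective e ->
  (forall j, 0 <= F j) -> \sum_i F (e i) <= \sum_j F j.
Proof.
move=> einj F0; rewrite (bigID (mem (imset e (mem predT))))/=.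
rewrite big_imset/=; last by move=> ? ? _ _; exact: einj.
by rewrite lerDl sumr_ge0.
Qed.

(** On a small cube around x0 the function and its partial derivatives are
   bounded, and the mean value theorem applies on segments of the cube. *)
Lemma blip_smooth n (I : finType) (e : 'I_n -> I) D (f : 'rV[R]_n -> R) x0 :
  injective e -> open D -> D x0 -> smooth_on D f ->
  \forall r \near (0 : R)^'+, blip (fun x : I -> R => f (clamp_row e x0 r x)).
Proof.
move=> einj oD Dx0 sf.
have c0 : {for x0, continuous f} by apply/differentiable_continuous/(sf [::]).
have ci i : {for x0, continuous (partial i f)}.
  by apply/differentiable_continuous/(sf [:: i]).
pose K := (`|f x0| + 1) + \sum_i (`|partial i f x0| + 1).
have K0 : 0 <= K by rewrite !addr_ge0// sumr_ge0// => i _; rewrite addr_ge0.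
have bnd (h : 'rV[R]_n -> R) : {for x0, continuous h} -> `|h x0| + 1 <= K ->
    \forall x \near x0, `|h x| <= K.
  move=> /cvgrPdist_lt/(_ _ ltr01) ch hK; apply: filterS ch => x hx.
  apply: le_trans hK; rewrite -lerBlDl (le_trans (lerB_dist _ _))// distrC.
  exact: ltW.
have n1 : \forall x \near x0, `|f x| <= K.
  by apply: bnd => //; rewrite lerDl sumr_ge0// => i _; rewrite addr_ge0.
have n2 : \forall x \near x0, forall i, `|partial i f x| <= K.
  apply: (@filter_forall _ _ (fun i x => `|partial i f x| <= K) (nbhs x0) _) => i.
  apply: bnd => //; rewrite /K (bigD1 i)//= addrCA lerDl !addr_ge0// sumr_ge0//.
have n3 : \forall x \near x0, D x by exact: open_nbhs_nbhs.
have : \forall x \near x0, [/\ `|f x| <= K, (forall i, `|partial i f x| <= K) & D x].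
  exact: filterS3 n1 n2 n3.
move=> /nbhs_ballP[rho /= rho0 rhoP].
near=> r.
have r0 : 0 <= r by near: r; exact: nbhs_right_ge.
have rr : r < rho by near: r; exact: nbhs_right_lt.
have inb z : `|z - x0| <= r -> [/\ `|f z| <= K, (forall i, `|partial i f z| <= K) & D z].
  by move=> zr; apply: rhoP; rewrite -ball_normE/= distrC; exact: le_lt_trans rr.
exists K => // x y; split.
  by have [] := inb _ (clamp_row_ball e x0 x r0).
set a := clamp_row _ _ _ x; set b := clamp_row _ _ _ y.
have ar : `|a - x0| <= r by exact: clamp_row_ball.
have br : `|b - x0| <= r by exact: clamp_row_ball.
have [s s01] : exists2 s : R, 0 <= s <= 1 &
    f (b + (a - b)) - f b = \sum_i (a - b) 0 i * partial i f (b + s *: (a - b)).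
  apply: MVT_line => s s01.
  by have [_ _ Dz] := inb _ (ball_segment s01 br ar); exact: (sf [::]).
rewrite [b + (a - b)]addrC subrK => ->.
have [_ pK _] := inb _ (ball_segment s01 br ar).
apply: le_trans (ler_norm_sum _ _ _) _.
apply: (@le_trans _ _ (\sum_i K * `|x (e i) - y (e i)|)).
  apply: ler_sum => i _; rewrite normrM mulrC ler_pM// !mxE.
  exact: clamp_lip.
rewrite -mulr_sumr ler_wpM2l//.
exact: (ler_sum_inj (F := fun j => `|x j - y j|)).
Unshelve. all: by end_near. Qed.

End LocalFlow.

(** * Local flow of quadratic differential equations *)

Section QuadraticFlow.
Context {R : realType} {n : nat}.
Variables (D : set 'rV[R]_n) (P : 'I_n -> 'I_n -> 'rV[R]_n -> R)
  (C : 'I_n -> 'I_n -> 'I_n -> 'rV[R]_n -> R).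
Hypotheses (oD : open D) (sP : forall l i, smooth_on D (P l i))
  (sC : forall j k l, smooth_on D (C j k l)).

(** These are the equations of dual-geodesics when x is the position and w the
   1-form dual to the velocity. *)
Definition flow_on (eps : R) (x w : R -> 'rV[R]_n) := forall t : R, `|t| < eps ->
  [/\ D (x t),
     forall i, is_derive t 1 (fun s => x s 0 i) (\sum_l P l i (x t) * w t 0 l) &
     forall j, is_derive t 1 (fun s => w s 0 j)
       (\sum_k \sum_l C j k l (x t) * w t 0 k * w t 0 l)].

(** Clamp (x, w) to a small cube around (x0, w0): this makes the right-hand
   side globally Lipschitz, and the solution stays in the cube for small
   times. *)
Lemma quadratic_flow x0 w0 : D x0 -> exists2 eps : R, 0 < eps &
  exists x w : R -> 'rV[R]_n, [/\ x 0 = x0, w 0 = w0 & flow_on eps x w].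
Proof.
move=> Dx0; pose I := ('I_n + 'I_n)%type.
have einj : injective (inl : 'I_n -> I) by move=> i j [].
have bP : \forall r \near (0 : R)^'+, forall t : 'I_n * 'I_n,
    blip (fun y : I -> R => P t.1 t.2 (clamp_row inl x0 r y)).
  apply: (@filter_forall _ _ (fun (t : 'I_n * 'I_n) r =>
    blip (fun y : I -> R => P t.1 t.2 (clamp_row inl x0 r y))) ((0:R)^'+) _) => t.
  exact: blip_smooth einj oD Dx0 (sP t.1 t.2).
have bC : \forall r \near (0 : R)^'+, forall t : 'I_n * 'I_n * 'I_n,
    blip (fun y : I -> R => C t.1.1 t.1.2 t.2 (clamp_row inl x0 r y)).
  apply: (@filter_forall _ _ (fun (t : 'I_n * 'I_n * 'I_n) r =>
    blip (fun y : I -> R => C t.1.1 t.1.2 t.2 (clamp_row inl x0 r y)))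
    ((0:R)^'+) _) => t.
  exact: blip_smooth einj oD Dx0 (sC t.1.1 t.1.2 t.2).
have bD : \forall r \near (0 : R)^'+, forall z, `|z - x0| <= r -> D z.
  have /nbhs_ballP[rho /= rho0 rhoD] := open_nbhs_nbhs (conj oD Dx0).
  have : \forall r \near (0 : R)^'+, r < rho by exact: nbhs_right_lt.
  apply: filterS => r rr z zr; apply: rhoD.
  by rewrite -ball_normE/= distrC; exact: le_lt_trans rr.
have bpos : \forall r \near (0 : R)^'+, 0 < r by exact: nbhs_right_gt.
near (0 : R)^'+ => r.
have bPr : forall t : 'I_n * 'I_n,
    blip (fun y : I -> R => P t.1 t.2 (clamp_row inl x0 r y)) by near: r.
have bCr : forall t : 'I_n * 'I_n * 'I_n,
    blip (fun y : I -> R => C t.1.1 t.1.2 t.2 (clamp_row inl x0 r y)) by near: r.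
have bDr : forall z, `|z - x0| <= r -> D z by near: r.
have r0 : 0 < r by near: r.
pose X (y : I -> R) := clamp_row inl x0 r y.
pose W l (y : I -> R) := clamp (w0 0 l) r (y (inr l)).
pose F (y : I -> R) (i : I) := match i with
  | inl i => \sum_l P l i (X y) * W l y
  | inr j => \sum_k \sum_l C j k l (X y) * W k y * W l y end.
have bW l : blip (W l) by exact/blip_clamp/ltW.
have bF i : blip (fun y => F y i).
  case: i => i /=; apply: blip_sum => l.
    by apply: blipM (bW l); exact: (bPr (l, i)).
  apply: blip_sum => m; apply: blipM (bW m); apply: blipM (bW l).
  exact: (bCr (i, l, m)).
have /choice[Ki KiP] : forall i, exists Ki : R, 0 <= Ki /\
    forall y z, `|F y i - F z i| <= Ki * \sum_j `|y j - z j|.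
  move=> i; have [Ki Ki0 KiP] := bF i; exists Ki; split=> // y z.
  by have [] := KiP y z.
pose K := \sum_i Ki i.
have Ki0 i : 0 <= Ki i by have [] := KiP i.
have K0 : 0 <= K by rewrite sumr_ge0.
pose y0 (i : I) := match i with inl i => x0 0 i | inr j => w0 0 j end.
have [y z i|delta delta0 [y [y_0 yE]]] := @picard R I F K y0 K0.
  have [_ /(_ y z)] := KiP i; move/le_trans; apply.
  rewrite ler_wpM2r ?sumr_ge0//.
  by rewrite /K (bigD1 i)//= lerDl sumr_ge0.
have near_y : \forall t \near (0 : R), forall i, `|y0 i - y t i| < r.
  apply: (@filter_forall _ _ (fun i t => `|y0 i - y t i| < r) (nbhs (0:R)) _) => i.
  have cy : {for (0 : R), continuous (fun s => y s i)}.
    apply: differentiable_continuous; apply/derivable1_diffP.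
    by have [] := yE 0 i; rewrite ?normr0.
  by move/cvgrPdist_lt : cy => /(_ _ r0); rewrite y_0.
have [e /= e0 eP] := (nbhs_ballP _ _).1 near_y.
exists (Num.min e delta); first by rewrite lt_min e0.
exists (fun t => \row_i y t (inl i)), (fun t => \row_i y t (inr i)); split.
- by apply/rowP => i; rewrite mxE y_0.
- by apply/rowP => i; rewrite mxE y_0.
move=> t; rewrite lt_min => /andP[te td].
have yt i : `|y t i - y0 i| <= r.
  by rewrite distrC ltW// eP//= -ball_normE/= sub0r normrN.
have XE : X (y t) = \row_i y t (inl i).
  by apply/rowP => i; rewrite !mxE clamp_id//; exact: (yt (inl i)).
have WE l : W l (y t) = (\row_i y t (inr i)) 0 l.
  by rewrite mxE /W clamp_id//; exact: (yt (inr l)).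
split=> [|i|j].
- by rewrite -XE; apply: bDr; apply: clamp_row_ball; exact: ltW.
- under eq_fun do rewrite mxE.
  have := yE t (inl i) td; rewrite /F XE.
  by under eq_bigr do rewrite WE.
- under eq_fun do rewrite mxE.
  have := yE t (inr j) td; rewrite /F XE.
  by under eq_bigr => k _ do under eq_bigr => l _ do rewrite !WE.
Unshelve. all: by end_near. Qed.

(** If the solution is of class C^k, so is the right-hand side along it. *)
Lemma flow_csmooth eps x w k : flow_on eps x w ->
  let J := [set t : R | `|t| < eps] in
  (forall i, csmooth k J (fun t => x t 0 i)) /\
  (forall i, csmooth k J (fun t => w t 0 i)).
Proof.
move=> fl J.
have oJ : open J.
  rewrite (_ : J = [set t | t \in `]- eps, eps[]).
    exact: interval_open.
  by apply/seteqP; split=> t; rewrite /J/= in_itv/= ltr_norml.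
elim: k => [//|k [IHx IHw]].
have JD t : J t -> D (x t) by move=> /fl[].
split=> i; split=> [t /fl[_ dx dw]|].
- by have [] := dx i.
- apply: (@csmooth_ext _ _ _ (fun t => \sum_l P l i (x t) * w t 0 l)) => //.
    by move=> t /fl[_ /(_ i)[_ <-] _]; rewrite derive1E.
  apply: csmooth_sum => // l _; apply: csmoothM => //.
  exact: csmooth_comp oJ JD ((smooth_onP _ _).1 (sP l i) k) IHx.
- by have [] := dw i.
- apply: (@csmooth_ext _ _ _
    (fun t => \sum_k \sum_l C i k l (x t) * w t 0 k * w t 0 l)) => //.
    by move=> t /fl[_ _ /(_ i)[_ <-]]; rewrite derive1E.
  apply: csmooth_sum => // l _; apply: csmooth_sum => // m _.
  apply: csmoothM => //; apply: csmoothM => //.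
  exact: csmooth_comp oJ JD ((smooth_onP _ _).1 (sC i l m) k) IHx.
Qed.

End QuadraticFlow.

(** * Charts and curves on the manifold *)

Section Charts.
Context {R : realType} {n : nat} (M : smooth_manifold R n).
Implicit Types (a b : chart M) (p q : M).

Definition chart_image a : set 'rV[R]_n := coord a @` dom a.

Lemma coord_param a x : chart_image a x ->
  dom a (param a x) /\ coord a (param a x) = x.
Proof. by move=> [p ap <-]; rewrite coordK. Qed.

Lemma near_chart_image a p : dom a p -> \forall x \near coord a p, chart_image a x.
Proof.
by move=> ap; apply: open_nbhs_nbhs; split; [exact: image_open|exists p].
Qed.

Lemma near_param a p (P : set M) : dom a p -> (\forall q \near p, P q) ->
  \forall x \near coord a p, P (param a x).
Proof.
move=> ap nP; have cx : chart_image a (coord a p) by exists p.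
by have := param_continuous cx; apply; rewrite coordK.
Qed.

Lemma near_dom a p : dom a p -> \forall q \near p, dom a q.
Proof. by move=> ap; apply: open_nbhs_nbhs; split=> //; exact: dom_open. Qed.

Lemma smooth_comp_diff a (f : M -> R) p : smooth_comp a f -> dom a p ->
  differentiable (f \o param a) (coord a p).
Proof. by move=> sf ap; apply: (sf [::]); exists p. Qed.

Lemma transition_diff a b k p : dom a p -> dom b p ->
  differentiable ((fun q => coord b q 0 k) \o param a) (coord a p).
Proof.
by move=> ap bp; apply: (@transition_smooth _ _ M a b k [::]); exists p.
Qed.

Lemma jac_diff a b i k p : dom a p -> dom b p ->
  differentiable ((fun q => jac a b q i k) \o param a) (coord a p).
Proof.
move=> ap bp.
have d : differentiable (partial i ((fun q => coord b q 0 k) \o param a)) (coord a p).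
  by apply: (@transition_smooth _ _ M a b k [:: i]); exists p.
apply: near_eq_differentiable d; have := near_chart_image ap.
by apply: filterS => x /coord_param[_ cx]; rewrite /= mxE /pd cx.
Qed.

End Charts.

Section CurvesInCharts.
Context {R : realType} {n : nat} (M : smooth_manifold R n).
Implicit Types (a b : chart M) (p q : M) (c : R -> M).

Definition curve_at c a (t : R) := [/\ {for t, continuous c}, dom a (c t) &
  forall i, derivable (fun s => coord a (c s) 0 i) t 1].

Lemma is_derive_along c a (t : R) (f : M -> R) : curve_at c a t ->
  differentiable (f \o param a) (coord a (c t)) ->
  is_derive t 1 (fun s => f (c s)) (\sum_i velocity c a t 0 i * pd a i f (c t)).
Proof.
move=> [cc act dc] df.
have d : is_derive t 1 (fun s => (f \o param a) (coord a (c s)))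
    (\sum_i velocity c a t 0 i * pd a i f (c t)).
  apply: (is_derive_curve (c := fun s => coord a (c s))) => // i.
  by rewrite mxE derive1E; exact: derivableP.
apply: near_eq_is_derive d.
have : \forall s \near t, dom a (c s) by apply: cc; exact: near_dom.
by apply: filterS => s ds; rewrite /= coordK.
Qed.

Lemma velocity_jac c a b (t : R) : curve_at c a t -> dom b (c t) ->
  velocity c b t = velocity c a t *m jac a b (c t).
Proof.
move=> ca bct; apply/rowP => k; rewrite !mxE derive1E.
have [_ act _] := ca.
have [_ ->] := is_derive_along ca (transition_diff k act bct).
by apply: eq_bigr => i _; rewrite [jac _ _ _ _ _]mxE.
Qed.

Lemma velocity_flat_jac (g : field2 M) c a b (t : R) : tensor02 g ->
  curve_at c a t -> dom b (c t) ->
  velocity_flat g c a t = velocity_flat g c b t *m (jac a b (c t))^T.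
Proof.
move=> [_ tg _] ca bct; have [_ act _] := ca.
by rewrite /velocity_flat (velocity_jac ca bct) (tg _ _ _ act bct) !mulmxA.
Qed.

(** The inhomogeneous term in the transformation law of N cancels the
   derivative of the Jacobian matrix along c. *)
Lemma cov_along_jac (N : field3 M) c (w : chart M -> R -> 'rV[R]_n) a b (t : R) :
  affine_connection N -> curve_at c a t -> dom b (c t) ->
  (\forall s \near t, w a s = w b s *m (jac a b (c s))^T) ->
  (forall j, derivable (fun s => w b s 0 j) t 1) ->
  cov_along N c w a t = cov_along N c w b t *m (jac a b (c t))^T.
Proof.
move=> [_ tN _] ca bct wab dw; have [_ act _] := ca.
have wt := nbhs_singleton wab.
have vE := velocity_jac ca bct.
apply/rowP => j; rewrite !mxE.
set v := velocity c a t in vE *; set v' := velocity c b t in vE *.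
set J := jac a b (c t) in wt vE *.
have dwa : is_derive t 1 (fun s => w a s 0 j)
    (\sum_m (w b t 0 m * (\sum_i v 0 i * pd a i (fun q => jac a b q j m) (c t))
      + J j m * derive1 (fun s => w b s 0 m) t)).
  have d : is_derive t 1 (\sum_m ((fun s => w b s 0 m) * (fun s => jac a b (c s) j m)))
    (\sum_m (w b t 0 m * (\sum_i v 0 i * pd a i (fun q => jac a b q j m) (c t))
      + J j m * derive1 (fun s => w b s 0 m) t)).
    apply: is_derive_sum => m.
    apply: (is_deriveM _ (is_derive_along ca (jac_diff j m act bct))).
    by rewrite derive1E; exact: derivableP.
  apply: near_eq_is_derive d; apply: filterS wab => s ->.
  by rewrite fct_sumE mxE; apply: eq_bigr => m _; rewrite mxE.
rewrite derive1E; have [_ ->] := dwa.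
have NE : \sum_i \sum_k N a (c t) i j k * v 0 i * w a t 0 k =
    \sum_r w b t 0 r * (\sum_i v 0 i * pd a i (fun q => jac a b q j r) (c t)) +
    \sum_m J j m * (\sum_l \sum_r N b (c t) l m r * v' 0 l * w b t 0 r).
  have e1 i : \sum_k N a (c t) i j k * v 0 i * w a t 0 k =
      \sum_r v 0 i * w b t 0 r * (\sum_k N a (c t) i j k * J k r).
    rewrite wt; under eq_bigr do rewrite [(_ *m _) _ _]mxE mulr_sumr.
    rewrite exchange_big; apply: eq_bigr => r _; rewrite mulr_sumr.
    by apply: eq_bigr => k _; rewrite [J^T _ _]mxE; ring.
  under eq_bigr do rewrite e1; rewrite exchange_big -big_split/=.
  rewrite [X in _ = X](_ : _ = \sum_r (w b t 0 r *
      (\sum_i v 0 i * pd a i (fun q => jac a b q j r) (c t)) +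
      \sum_m \sum_l J j m * (N b (c t) l m r * v' 0 l * w b t 0 r))); last first.
    rewrite !big_split/=; congr (_ + _); rewrite [RHS]exchange_big.
    apply: eq_bigr => m _; rewrite [RHS]exchange_big mulr_sumr.
    by apply: eq_bigr => l _; rewrite mulr_sumr.
  apply: eq_bigr => r _.
  under eq_bigr do rewrite (tN _ _ _ act bct) mulrDr.
  rewrite big_split/=; congr (_ + _).
    by rewrite mulr_sumr; apply: eq_bigr => i _; ring.
  under eq_bigr do rewrite mulr_sumr.
  rewrite exchange_big/= [RHS]exchange_big/=; apply: eq_bigr => l _.
  under eq_bigr do rewrite mulr_sumr.
  rewrite exchange_big/=; apply: eq_bigr => m _.
  rewrite vE [(_ *m _) _ _]mxE mulr_sumr mulr_suml mulr_sumr.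
  by apply: eq_bigr => i _; ring.
rewrite NE big_split/= opprD addrACA subrr add0r -sumrB.
apply: eq_bigr => m _; rewrite !mxE; ring.
Qed.

End CurvesInCharts.

(** * The metric and the tensor B *)

Section Metric.
Context {R : realType} {n : nat} (M : smooth_manifold R n).
Variables (g : field2 M).
Hypothesis hg : riemannian_metric g.
Implicit Types (a b : chart M) (p q : M).

Lemma eval2E (h : 'M[R]_n) X Y : eval2 h X Y = (X *m h *m Y^T) 0 0.
Proof.
rewrite /eval2 mxE exchange_big; apply: eq_bigr => j _.
rewrite !mxE mulr_suml; apply: eq_bigr => i _; ring.
Qed.

(** A nonzero vector in the kernel of g would be isotropic. *)
Lemma metric_unit a p : dom a p -> g a p \in unitmx.
Proof.
move=> ap; have [_ _ gpos] := hg; apply: contraT.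
rewrite -row_free_unit -kermx_eq0 => /rowV0Pn[X /sub_kermxP Xg X0].
by have := gpos a p ap X X0; rewrite eval2E Xg mul0mx mxE ltxx.
Qed.

Lemma metric_sym a p : (g a p)^T = g a p.
Proof. by have [_ gs _] := hg; rewrite -gs. Qed.

Lemma metric_symE a p i j : g a p i j = g a p j i.
Proof. by rewrite -[in LHS]metric_sym mxE. Qed.

Lemma metric_jac a b p : dom a p -> dom b p ->
  g a p = jac a b p *m g b p *m (jac a b p)^T.
Proof. by have [[_ + _] _ _] := hg; apply. Qed.

(** The Jacobian matrix is a factor of the invertible matrix of g. *)
Lemma jac_unit a b p : dom a p -> dom b p -> jac a b p \in unitmx.
Proof.
move=> ap bp; have := metric_unit ap; rewrite (metric_jac ap bp).
by rewrite !unitmx_mul -andbA => /andP[].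
Qed.

Section Connection.
Variables (That : field3 M).
Hypothesis hT : tensor12 That.

(** The trace is taken over the endomorphism Y |-> That(d_i, Y), and traces are
   invariant under conjugation by the Jacobian matrix. *)
Lemma t_form_jac a b p : dom a p -> dom b p ->
  t_form That a p = t_form That b p *m (jac a b p)^T.
Proof.
move=> ap bp; have [_ tT _] := hT; have uJ := jac_unit ap bp.
pose A c i := \matrix_(j, k) That c p i j k.
have tr c i : t_form That c p 0 i = n%:R / ((n%:R - 1) * (n%:R + 2)) * \tr (A c i).
  by rewrite mxE; congr (_ * _); apply: eq_bigr => j _; rewrite mxE.
have AE i : A a i = jac a b p *m (\sum_l jac a b p i l *: A b l) *m invmx (jac a b p).
  rewrite -[LHS](mulmxK uJ); congr (_ *m _); apply/matrixP => j r.
  have -> : (A a i *m jac a b p) j r = \sum_k That a p i j k * jac a b p k r.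
    by rewrite [LHS]mxE; apply: eq_bigr => k _; rewrite [A _ _ _ _]mxE.
  rewrite (tT _ _ _ ap bp) [RHS]mxE exchange_big; apply: eq_bigr => m _.
  rewrite summxE mulr_sumr; apply: eq_bigr => l _.
  rewrite !mxE; ring.
apply/rowP => i; rewrite [RHS]mxE tr AE mxtrace_mulC mulmxA mulVmx// mul1mx.
rewrite linear_sum mulr_sumr; apply: eq_bigr => l _.
rewrite tr linearZ [(_^T) _ _]mxE /=; ring.
Qed.

Definition t_sharp : field1 M := fun a p => t_form That a p *m invmx (g a p).

Lemma t_sharp_jac a b p : dom a p -> dom b p ->
  t_sharp a p *m jac a b p = t_sharp b p.
Proof.
move=> ap bp; have uJ := jac_unit ap bp.
have uJT : (jac a b p)^T \in unitmx by rewrite unitmx_tr.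
have ga : invmx (g a p) =
    invmx (jac a b p)^T *m invmx (g b p) *m invmx (jac a b p).
  rewrite -[LHS]mulmx1; apply: (canLR (mulKmx (metric_unit ap))).
  have ub := metric_unit bp.
  by rewrite (metric_jac ap bp) !mulmxA mulmxK// mulmxK// mulmxV.
rewrite /t_sharp (t_form_jac ap bp) ga !mulmxA mulmxK//.
by rewrite -mulmxA mulVmx// mulmx1.
Qed.

Lemma BhatE a p i j k : dom a p -> Bhat g That a p i j k =
  That a p i j k + (n%:R + 2) / n%:R * g a p i j * t_sharp a p 0 k.
Proof.
move=> ap; have ug := metric_unit ap.
rewrite /Bhat /raise3 /B_tensor /lower3.
under eq_bigr do rewrite mulrDl.
rewrite big_split/=; congr (_ + _).
  have -> : \sum_l (\sum_k That a p i j k * g a p k l) * invmx (g a p) l k =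
      ((\row_k That a p i j k) *m g a p *m invmx (g a p)) 0 k.
    rewrite [RHS]mxE; apply: eq_bigr => l _; rewrite [in RHS]mxE.
    by congr (_ * _); apply: eq_bigr => m _; rewrite [(\row__ _) _ _]mxE.
  by rewrite mulmxK// mxE.
rewrite [t_sharp _ _ _ _]mxE mulr_sumr; apply: eq_bigr => l _; ring.
Qed.

Lemma Bhat_out a p i j k : ~ dom a p -> Bhat g That a p i j k = 0.
Proof.
move=> ap; have [_ _ T0] := hT; have [[_ _ g0] _ _] := hg.
rewrite /Bhat /raise3 big1// => l _; rewrite /B_tensor /lower3 g0// mxE mulr0 mul0r.
by rewrite big1 ?addr0 ?mul0r// => m _; rewrite T0// mul0r.
Qed.

Lemma smooth_invmx a i j : smooth_comp a (fun p => invmx (g a p) i j).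
Proof.
apply: (@smooth_on_invmx _ _ _ _ (g a \o param a)); first exact: image_open.
  by move=> x /coord_param[ax _]; exact: metric_unit.
by have [[sg _ _] _ _] := hg; exact: sg.
Qed.

Lemma tensor12_Bhat : tensor12 (Bhat g That).
Proof.
have [sT tT T0] := hT; have [[sg _ g0] _ _] := hg; split.
- move=> a i j k; have oD := @image_open _ _ M a.
  have st l : smooth_comp a (fun p => t_form That a p 0 l).
    rewrite /smooth_comp /comp.
    under eq_fun do rewrite mxE.
    apply: smooth_onM => //; first exact: smooth_on_cst.
    by apply: smooth_on_sum => // m _; exact: sT.
  apply: (@smooth_on_ext _ _ _ (fun x => That a (param a x) i j k +
      (n%:R + 2) / n%:R * g a (param a x) i j *
        \sum_l t_form That a (param a x) 0 l * invmx (g a (param a x)) l k)) => //.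
    by move=> x; rewrite inE => /coord_param[ax _]; rewrite /= BhatE// [t_sharp _ _ _ _]mxE.
  apply: smooth_onD => //; first exact: sT.
  apply: smooth_onM => //.
    by apply: smooth_onM => //; [exact: smooth_on_cst|exact: sg].
  apply: smooth_on_sum => // l _; apply: smooth_onM => //; first exact: st.
  exact: smooth_invmx.
- move=> a b p ap bp i j r.
  under eq_bigr do rewrite BhatE// mulrDl.
  under [in RHS]eq_bigr => l _ do under eq_bigr => m _ do rewrite BhatE// mulrDr.
  rewrite big_split/= tT//.
  under [in RHS]eq_bigr => l _ do rewrite big_split/=.
  rewrite [RHS]big_split/=; congr (_ + _).
  transitivity ((n%:R + 2) / n%:R * g a p i j * t_sharp b p 0 r).
    rewrite -(t_sharp_jac ap bp) [(_ *m _) _ _]mxE mulr_sumr.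
    by apply: eq_bigr => k _; rewrite mulrA.
  rewrite (metric_jac ap bp) [(_ *m _^T) _ _]mxE mulr_sumr mulr_suml.
  rewrite exchange_big; apply: eq_bigr => m _.
  rewrite [(_ *m g b p) _ _]mxE [_^T _ _]mxE mulr_suml mulr_sumr mulr_suml.
  by apply: eq_bigr => l _; ring.
- by move=> a p ap i j k; exact: Bhat_out.
Qed.

End Connection.

Lemma affine_conn_sub (N A : field3 M) : affine_connection N -> tensor12 A ->
  affine_connection (conn_sub N A).
Proof.
move=> [sN tN N0] [sA tA A0]; split.
- move=> a i j k; apply: smooth_onD; [exact: image_open|exact: sN|].
  by apply: smooth_onN; [exact: image_open|exact: sA].
- move=> a b p ap bp i j r; rewrite /conn_sub.
  under eq_bigr do rewrite mulrBl.
  rewrite sumrB (tN _ _ _ ap bp) (tA _ _ _ ap bp) -addrA; congr (_ + _).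
  rewrite -sumrB; apply: eq_bigr => l _; rewrite -sumrB; apply: eq_bigr => m _; ring.
- by move=> a p ap i j k; rewrite /conn_sub N0// A0// subr0.
Qed.

End Metric.

(** * Dual-geodesics *)

Section DualGeodesics.
Context {R : realType} {n : nat} (M : smooth_manifold R n).
Variables (g : field2 M).
Hypothesis hg : riemannian_metric g.
Implicit Types (a b : chart M) (p q : M).

Lemma smooth_curve_at eps (c : R -> M) a (t : R) : smooth_curve eps c ->
  t \in `]- eps, eps[ -> dom a (c t) -> curve_at c a t.
Proof.
by move=> sc te act; have [cc dc] := sc t te; split=> // i; exact: (dc a act i 0%N).
Qed.

Lemma flat_sharp c a (t : R) : dom a (c t) ->
  velocity_flat g c a t *m invmx (g a (c t)) = velocity c a t.
Proof. by move=> act; rewrite /velocity_flat mulmxK// (metric_unit hg). Qed.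

Lemma cov_along_shift (N1 N2 That : field3 M) (s : R) c a (t : R) : dom a (c t) ->
  (forall i j k, N1 a (c t) i j k =
     N2 a (c t) i j k + s * g a (c t) i j * t_sharp g That a (c t) 0 k) ->
  cov_along N1 c (velocity_flat g c) a t =
  cov_along N2 c (velocity_flat g c) a t -
    (s * (\sum_k t_form That a (c t) 0 k * velocity c a t 0 k)) *: velocity_flat g c a t.
Proof.
move=> act NE; apply/rowP => j; rewrite [LHS]mxE [RHS]mxE [in RHS]mxE -addrA.
congr (_ + _); rewrite [X in _ = _ + X]mxE [X in _ = _ - X]mxE -opprD; congr (- _).
set v := velocity c a t; set w := velocity_flat g c a t.
under eq_bigr => i _ do under eq_bigr => k _ do rewrite NE 2!mulrDl.
under eq_bigr => i _ do rewrite big_split/=.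
rewrite big_split/=; congr (_ + _).
have tv : \sum_k t_form That a (c t) 0 k * v 0 k =
    \sum_k t_sharp g That a (c t) 0 k * w 0 k.
  have dot (x y : 'rV[R]_n) : \sum_k x 0 k * y 0 k = (x *m y^T) 0 0.
    by rewrite mxE; apply: eq_bigr => k _; rewrite mxE.
  rewrite !dot /t_sharp /w /velocity_flat trmx_mul (metric_sym hg) !mulmxA.
  by rewrite mulmxKV// (metric_unit hg).
have wj : w 0 j = \sum_i v 0 i * g a (c t) i j by rewrite /w /velocity_flat mxE.
rewrite tv wj mulr_sumr; apply: eq_bigr => i _.
rewrite mulr_sumr mulr_suml; apply: eq_bigr => k _; ring.
Qed.

(** The additional term is absorbed by the factor q; this needs that the
   scalar t(velocity) is the same in all charts. *)
Lemma dual_geodesic_shift (N1 N2 That : field3 M) (s : R) eps c : tensor12 That ->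
  (forall a p, dom a p -> forall i j k, N1 a p i j k =
     N2 a p i j k + s * g a p i j * t_sharp g That a p 0 k) ->
  dual_geodesic g N2 eps c -> dual_geodesic g N1 eps c.
Proof.
move=> hT NE [sc [q qE]]; split=> //.
pose ch p := projT1 (cid (dom_cover p)).
have chP p : dom (ch p) p by rewrite /ch; case: cid.
pose tv a t := \sum_k t_form That a (c t) 0 k * velocity c a t 0 k.
exists (fun t => q t - s * tv (ch (c t)) t) => t te a act.
rewrite (cov_along_shift act (NE a _ act)) (qE t te a act) scalerBl.
suff -> : tv (ch (c t)) t = tv a t by [].
have dot (x y : 'rV[R]_n) : \sum_k x 0 k * y 0 k = (x *m y^T) 0 0.
  by rewrite mxE; apply: eq_bigr => k _; rewrite mxE.
rewrite /tv !dot (t_form_jac hg hT (chP _) act).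
by rewrite (velocity_jac (smooth_curve_at sc te (chP _)) act) trmx_mul mulmxA.
Qed.

(** In terms of the position x and the 1-form w dual to the velocity, the
   equations x' = w^sharp and (cov. derivative of w) = 0 are quadratic in w and
   contain no derivative of g.  They are solved in the chart a and carried
   over to the other charts by the transformation law. *)
Lemma dual_geodesic_exists (N : field3 M) a p (w0 : 'rV[R]_n) :
  affine_connection N -> dom a p -> exists2 eps : R, 0 < eps &
  exists c : R -> M, [/\ c 0 = p, dual_geodesic g N eps c &
    velocity_flat g c a 0 = w0].
Proof.
move=> hN ap; have [sN _ _] := hN.
pose D := chart_image a; have oD : open D by exact: image_open.
pose P l i x := invmx (g a (param a x)) l i.
pose C (j k l : 'I_n) x := \sum_i P l i x * N a (param a x) i j k.
have sP l i : smooth_on D (P l i) by exact: smooth_invmx.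
have sC j k l : smooth_on D (C j k l).
  by apply: smooth_on_sum => // i _; apply: smooth_onM => //; exact: sN.
have Dp : D (coord a p) by exists p.
have [eps eps0 [x [w [x_0 w_0 fl]]]] := quadratic_flow oD sP sC w0 Dp.
exists eps => //; exists (fun t => param a (x t)).
set c := fun t => param a (x t).
pose J := [set t : R | `|t| < eps].
have ac t : J t -> dom a (c t) by move=> /fl[/coord_param[]].
have xc t : J t -> coord a (c t) = x t by move=> /fl[/coord_param[]].
have itvJ t : (t \in `]- eps, eps[) = (`|t| < eps) by rewrite in_itv/= ltr_norml.
have oJ : open J.
  rewrite (_ : J = [set t | t \in `]- eps, eps[]); first exact: interval_open.
  by apply/seteqP; split=> t; rewrite /J/= itvJ.
have nJ t : J t -> \forall s \near t, J s by move=> Jt; exact: open_nbhs_nbhs.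
have cx t : J t -> {for t, continuous x}.
  move=> /fl[_ dx _]; apply/differentiable_continuous/derivable1_diffP.
  by apply/derivable_mxP => i j; rewrite ord1; have [] := dx j.
have cc t : J t -> {for t, continuous c}.
  move=> Jt; apply: continuous_comp; first exact: cx.
  by apply: param_continuous; have [] := fl t Jt.
have sc : smooth_curve eps c.
  move=> t; rewrite itvJ => Jt; split; first exact: cc.
  move=> b bct i m.
  pose D' := coord a @` (dom a `&` dom b).
  pose J' := [set s | J s /\ dom b (c s)].
  have oJ' : open J'.
    rewrite openE => s [Js bs]; apply: filterI; first exact: nJ.
    by apply: (cc s Js); exact: near_dom.
  have J'D s : J' s -> D' (x s).
    by move=> [Js bs]; exists (c s); [split=> //; exact: ac|exact: xc].
  apply: (@csmooth_derivable _ m J'); last by [].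
  have oD' : open D'.
    rewrite openE => _ [q [aq bq] <-].
    have := near_param aq (near_dom bq); have := near_chart_image aq.
    apply: filterS2 => y /coord_param[ay <-] by_; rewrite coordK// in by_ *.
    by exists (param a y); rewrite ?coordK.
  apply: (@csmooth_comp _ n _ J' D' (fun y => coord b (param a y) 0 i) x) => //.
    by apply: ((smooth_onP _ _).1 _ m.+1); exact: transition_smooth.
  move=> j; apply: (@csmoothS _ _ J); first by move=> s [].
  by have [+ _] := flow_csmooth sP sC m.+1 fl; apply.
have vE t : J t -> velocity c a t = w t *m invmx (g a (c t)).
  move=> Jt; apply/rowP => i; rewrite !mxE derive1E.
  have [_ dx _] := fl t Jt; have [_ dxi] := dx i.
  rewrite (@near_eq_derive _ _ _ _ (fun s => x s 0 i)).
    by rewrite dxi; apply: eq_bigr => l _; rewrite mulrC.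
  by apply: filterS (nJ t Jt) => s Js; rewrite xc.
have wE t : J t -> velocity_flat g c a t = w t.
  move=> Jt; rewrite /velocity_flat vE// mulmxKV//; apply: (metric_unit hg).
  exact: ac.
have J0 : J 0 by rewrite /J/= normr0.
split; last by rewrite wE.
  by rewrite /c x_0 coordK.
split=> //; exists (fun=> 0) => t; rewrite itvJ => Jt b bct.
have act := ac t Jt.
have nw j : \forall s \near t, velocity_flat g c a s 0 j = w s 0 j.
  by apply: filterS (nJ t Jt) => s Js; rewrite wE.
have cov0 : cov_along N c (velocity_flat g c) a t = 0.
  apply/rowP => j; rewrite !mxE derive1E (near_eq_derive _ (nw j)).
  have [_ _ /(_ j)[_ ->]] := fl t Jt.
  apply/eqP; rewrite subr_eq0; apply/eqP.
  rewrite wE// vE// /C exchange_big.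
  under eq_bigr => l _ do under eq_bigr => k _ do rewrite 2!mulr_suml.
  rewrite exchange_big [RHS]exchange_big; apply: eq_bigr => k _ /=.
  rewrite exchange_big; apply: eq_bigr => i _ /=.
  rewrite [(_ *m _) _ _]mxE mulr_sumr mulr_suml; apply: eq_bigr => l _.
  rewrite /P /c; ring.
have te : t \in `]- eps, eps[ by rewrite itvJ.
have cb := smooth_curve_at sc te bct.
rewrite scale0r (cov_along_jac hN cb act) ?cov0 ?mul0mx//.
- have nb : \forall s \near t, dom b (c s) by apply: (cc t Jt); exact: near_dom.
  apply: filterS2 nb (nJ t Jt) => s bs Js.
  have [tg _ _] := hg.
  have se : s \in `]- eps, eps[ by rewrite itvJ.
  exact: velocity_flat_jac tg (smooth_curve_at sc se bs) (ac s Js).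
- move=> j; have [_ _ /(_ j)[dw _]] := fl t Jt.
  by apply: near_eq_derivable dw; apply: filterS (nw j) => s ->.
Qed.

End DualGeodesics.

(** * Cubic forms *)

Section CubicForms.
Context {R : realType} {n : nat}.
Implicit Types (A : 'I_n -> 'I_n -> 'I_n -> R) (X Y Z : 'rV[R]_n).

Lemma eval3_delta A i j k :
  eval3 A (delta_mx 0 i) (delta_mx 0 j) (delta_mx 0 k) = A i j k.
Proof.
rewrite /eval3 (bigD1 i)//= [X in _ + X]big1 ?addr0; last first.
  move=> l li; rewrite big1// => m _; rewrite big1// => m' _.
  by rewrite !mxE (negbTE li) andbF !(mulr0, mul0r).
rewrite (bigD1 j)//= [X in _ + X]big1 ?addr0; last first.
  by move=> l li; rewrite big1// => m _; rewrite !mxE (negbTE li) andbF !(mulr0, mul0r).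
rewrite (bigD1 k)//= [X in _ + X]big1 ?addr0; last first.
  by move=> l li; rewrite !mxE (negbTE li) andbF !(mulr0, mul0r).
by rewrite !mxE !eqxx !mulr1.
Qed.

Lemma eval3_swap12 A X Y Z : eval3 A X Y Z = eval3 (fun i j k => A j i k) Y X Z.
Proof.
rewrite /eval3 exchange_big; apply: eq_bigr => i _; apply: eq_bigr => j _.
by apply: eq_bigr => k _; ring.
Qed.

Lemma eval3_swap23 A X Y Z : eval3 A X Y Z = eval3 (fun i j k => A i k j) X Z Y.
Proof.
rewrite /eval3; apply: eq_bigr => i _; rewrite exchange_big.
by apply: eq_bigr => j _; apply: eq_bigr => k _; ring.
Qed.

Lemma eval3_linear A c X X' Y Z :
  eval3 A (X + c *: X') Y Z = eval3 A X Y Z + c * eval3 A X' Y Z.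
Proof.
rewrite /eval3 mulr_sumr -big_split; apply: eq_bigr => i _ /=.
rewrite mulr_sumr -big_split; apply: eq_bigr => j _ /=.
rewrite mulr_sumr -big_split; apply: eq_bigr => k _ /=.
rewrite !mxE; ring.
Qed.

Lemma eval2_linear (G : 'M[R]_n) c X X' Y :
  eval2 G (X + c *: X') Y = eval2 G X Y + c * eval2 G X' Y.
Proof. by rewrite !eval2E !mulmxDl -!scalemxAl !mxE. Qed.

Lemma eval2_sym (G : 'M[R]_n) X Y : G^T = G -> eval2 G X Y = eval2 G Y X.
Proof.
move=> Gs; rewrite /eval2 exchange_big; apply: eq_bigr => i _.
by apply: eq_bigr => j _; rewrite -[in LHS]Gs mxE mulrAC.
Qed.

(** Let X and Y be nonzero and orthogonal, a = G(X, X) and b = G(Y, Y).  As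
   X + s Y and s b X - a Y are orthogonal, A(X + s Y, X + s Y, s b X - a Y) = 0
   for all s.  The terms of degree 1 in s give A(X, X, X) = 0, hence
   A(X, X, .) = 0, and polarization concludes.  The existence of Y is where the
   dimension matters. *)
Lemma cubic_form_eq0 A (G : 'M[R]_n) : (2 <= n)%N ->
  G^T = G -> (forall X, X != 0 -> 0 < eval2 G X X) ->
  (forall i j k, A i j k = A j i k) -> (forall i j k, A i j k = A i k j) ->
  (forall X, exists l : R, forall Y, eval3 A X X Y = l * eval2 G X Y) ->
  forall i j k, A i j k = 0.
Proof.
move=> n2 Gs Gpos A12 A23 Aprop.
have s12 X Y Z : eval3 A X Y Z = eval3 A Y X Z.
  rewrite eval3_swap12; congr eval3; apply/funext => i; apply/funext => j.
  by apply/funext => k; rewrite A12.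
have s23 X Y Z : eval3 A X Y Z = eval3 A X Z Y.
  rewrite eval3_swap23; congr eval3; apply/funext => i; apply/funext => j.
  by apply/funext => k; rewrite A23.
have lin1 := eval3_linear A.
have lin2 c X X' Y Z : eval3 A Y (X + c *: X') Z = eval3 A Y X Z + c * eval3 A Y X' Z.
  by rewrite s12 lin1 (s12 X) (s12 X').
have lin3 c X X' Y Z : eval3 A Y Z (X + c *: X') = eval3 A Y Z X + c * eval3 A Y Z X'.
  by rewrite s23 lin2 (s23 _ X) (s23 _ X').
have orth X Y : eval2 G X Y = 0 -> eval3 A X X Y = 0.
  by have [l ->] := Aprop X => ->; rewrite mulr0.
have cube X : eval3 A X X X = 0.
  have [->|X0] := eqVneq X 0.
    by have [l ->] := Aprop 0; rewrite eval2E !mul0mx mxE mulr0.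
  have [Y Y0 XY] : exists2 Y : 'rV[R]_n, Y != 0 & eval2 G X Y = 0.
    have : kermx (G *m X^T) != 0.
      rewrite kermx_eq0; apply/negP => /eqP rf.
      have := rank_leq_col (G *m X^T); rewrite rf => n1.
      by have := leq_trans n2 n1.
    move=> /rowV0Pn[Y /sub_kermxP YG Y0]; exists Y => //.
    by rewrite eval2_sym// eval2E -mulmxA YG mxE.
  have YX : eval2 G Y X = 0 by rewrite eval2_sym.
  set a := eval2 G X X; set b := eval2 G Y Y.
  have b0 : 0 < b by exact: Gpos.
  have key (s : R) : s * b * eval3 A X X X - a * s ^+ 2 * eval3 A Y Y Y = 0.
    have XXY := orth _ _ XY; have YYX := orth _ _ YX.
    have XYX : eval3 A X Y X = 0 by rewrite s23.
    have YXX : eval3 A Y X X = 0 by rewrite s12.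
    have XYY : eval3 A X Y Y = 0 by rewrite s12 s23.
    have YXY : eval3 A Y X Y = 0 by rewrite s23.
    have := @orth (X + s *: Y) ((s * b) *: X + (- a) *: Y).
    rewrite -[(s * b) *: X]add0r !(lin1, lin2, lin3) !eval2_linear.
    have z3 U V : eval3 A U V 0 = 0.
      rewrite /eval3 big1// => i _; rewrite big1// => j _; rewrite big1// => k _.
      by rewrite mxE mulr0.
    rewrite !z3 XXY YYX XYX YXX XYY YXY.
    rewrite ![eval2 G _ (_ + _)]eval2_sym// !eval2_linear.
    have z2 U : eval2 G 0 U = 0 by rewrite eval2E !mul0mx mxE.
    rewrite !z2 XY YX -/a -/b => h.
    by rewrite -[RHS]h; ring.
  have k1 := key 1; have k2 := key (-1).
  have : b * eval3 A X X X = 0 by move: k1 k2; rewrite sqrrN !expr1n; lra.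
  by move/eqP; rewrite mulf_eq0 gt_eqF//= => /eqP.
have sq X Y : eval3 A X X Y = 0.
  have [->|X0] := eqVneq X 0.
    by have [l ->] := Aprop 0; rewrite eval2E !mul0mx mxE mulr0.
  have [l lE] := Aprop X; rewrite lE.
  have := lE X; rewrite cube => /esym/eqP; rewrite mulf_eq0.
  by rewrite (gt_eqF (Gpos _ X0)) orbF => /eqP ->; rewrite mul0r.
move=> i j k; rewrite -eval3_delta.
set X := delta_mx 0 i; set Y := delta_mx 0 j; set Z := delta_mx 0 k.
have := sq (X + 1 *: Y) Z.
by rewrite !(lin1, lin2) !sq (s12 Y X); lra.
Qed.

End CubicForms.

(** * Compatible connections *)

Section CompatibleConnections.
Context {R : realType} {n : nat} (M : smooth_manifold R n).
Variables (g : field2 M).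
Hypothesis hg : riemannian_metric g.
Implicit Types (a b : chart M) (p q : M).

Lemma compatibleP (N : field3 M) : compatible N g <->
  forall a p, dom a p -> forall i j k, cov2 N g a p i j k = cov2 N g a p j i k.
Proof.
have e0 X : eval1 (0 : 'rV[R]_n) X = 0.
  by rewrite /eval1 big1// => i _; rewrite mxE mul0r.
split=> [cN a p ap i j k|cN a p ap X Y Z].
  have := cN a p ap (delta_mx 0 i) (delta_mx 0 j) (delta_mx 0 k).
  by rewrite !e0 !mul0r subrr !eval3_delta => /subr0_eq.
rewrite !e0 !mul0r subrr; apply/eqP; rewrite subr_eq0; apply/eqP.
rewrite eval3_swap12; congr eval3; apply/funext => i; apply/funext => j.
by apply/funext => k; exact: cN.
Qed.

Lemma lower_raise (B : field3 M) a p i j k : dom a p ->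
  lower3 g (raise3 g B) a p i j k = B a p i j k.
Proof.
move=> ap; rewrite /lower3 /raise3.
have -> : \sum_m (\sum_l B a p i j l * invmx (g a p) l m) * g a p m k =
    ((\row_l B a p i j l) *m invmx (g a p) *m g a p) 0 k.
  rewrite [RHS]mxE; apply: eq_bigr => m _; rewrite [in RHS]mxE; congr (_ * _).
  by apply: eq_bigr => l _; rewrite [(\row__ _) _ _]mxE.
by rewrite mulmxKV ?(metric_unit hg)// mxE.
Qed.

Lemma lower_inj (A : field3 M) a p : dom a p ->
  (forall i j k, lower3 g A a p i j k = 0) -> forall i j k, A a p i j k = 0.
Proof.
move=> ap A0 i j k.
have : (\row_m A a p i j m) *m g a p = 0.
  apply/rowP => l; rewrite !mxE -[RHS](A0 i j l).
  by apply: eq_bigr => m _; rewrite mxE.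
move=> /(congr1 (mulmx^~ (invmx (g a p)))); rewrite mul0mx mulmxK ?(metric_unit hg)//.
by move=> /rowP/(_ k); rewrite !mxE.
Qed.

Lemma cov2_sub (N A : field3 M) a p i j k :
  cov2 (conn_sub N A) g a p i j k =
  cov2 N g a p i j k + lower3 g A a p i j k + lower3 g A a p i k j.
Proof.
rewrite /cov2 /conn_sub /lower3.
under eq_bigr do rewrite mulrBl.
rewrite sumrB.
under [X in _ - _ - X]eq_bigr do rewrite mulrBl.
rewrite sumrB.
have -> : \sum_m A a p i k m * g a p j m = \sum_m A a p i k m * g a p m j.
  by apply: eq_bigr => m _; rewrite (metric_symE hg).
ring.
Qed.

Lemma levi_civita0 (N : field3 M) a p i j k : levi_civita g N -> dom a p ->
  cov2 N g a p i j k = 0.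
Proof. by move=> [_ _ lc] ap; rewrite -eval3_delta lc. Qed.

(** The antisymmetrization of the covariant derivative of g, which is zero for
   the Levi-Civita connection, becomes A_ijk + A_ikj - A_jik - A_jki. *)
Lemma compatible_sub (N A : field3 M) : levi_civita g N ->
  (forall a p, dom a p -> forall i j k, lower3 g A a p i j k = lower3 g A a p j i k) ->
  (forall a p, dom a p -> forall i j k, lower3 g A a p i j k = lower3 g A a p i k j) ->
  compatible (conn_sub N A) g.
Proof.
move=> lc A12 A23; apply/compatibleP => a p ap i j k.
rewrite !cov2_sub !levi_civita0// !add0r.
by rewrite (A12 _ _ ap) (A23 _ _ ap i k j) (A12 _ _ ap i j k) (A23 _ _ ap j k i).
Qed.

(** The lowered difference of the connections is symmetric in its first two
   arguments, as they are torsion-free, and in its outer arguments, as they are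
   compatible.  A common dual-geodesic runs through every vector v, so that the
   difference maps (v, v) to a multiple of v^flat. *)
Lemma compatible_unique (N N' : field3 M) : (2 <= n)%N ->
  affine_connection N -> torsion_free N -> compatible N g ->
  affine_connection N' -> torsion_free N' -> compatible N' g ->
  dual_projectively_equivalent g N N' -> N = N'.
Proof.
move=> n2 aN tN cN aN' tN' cN' dNN'.
pose A := conn_sub N N'.
apply/funext => a; apply/funext => p; apply/funext => i; apply/funext => j.
apply/funext => k.
have [ap|ap] := pselect (dom a p); last first.
  by have [_ _ ->] := aN => //; have [_ _ ->] := aN'.
apply/subr0_eq; rewrite -[LHS]/(A a p i j k); move: i j k; apply: lower_inj => //.
pose L i j k := lower3 g A a p i j k.
have L12 i j k : L i j k = L j i k.
  by rewrite /L /lower3; apply: eq_bigr => m _; rewrite /A /conn_sub tN tN'.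
have L23 i j k : L i j k = L i k j.
  have NA : N' = conn_sub N A.
    apply/funext => b; apply/funext => q; apply/funext => i'; apply/funext => j'.
    by apply/funext => k'; rewrite /A /conn_sub opprB addrC subrK.
  have/compatibleP/(_ a p ap) cA := cN'; have/compatibleP/(_ a p ap) cAN := cN.
  have L13 x y z : L x y z = L z y x.
    have := cA x z y; rewrite NA !cov2_sub (cAN x z y) -!/(L _ _ _) (L12 x z y).
    by move: (cov2 _ _ _ _ _ _ _) => u; lra.
  by rewrite L12 L13 L12.
have [_ _ gpos] := hg.
apply: (cubic_form_eq0 n2 (metric_sym hg a p) (gpos a p ap) L12 L23) => v.
pose w := v *m g a p.
have [eps eps0 [c [c0 dc wc]]] := dual_geodesic_exists hg w aN' ap.
have e0 : (0 : R) \in `]- eps, eps[ by rewrite in_itv/= oppr_lt0 eps0.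
have ac : dom a (c 0) by rewrite c0.
have vc : velocity c a 0 = v.
  by rewrite -(flat_sharp hg ac) wc /w c0 mulmxK// (metric_unit hg).
have [_ [q' /(_ 0 e0 a ac) cov']] := dc.
have [_ [q /(_ 0 e0 a ac) cov]] := (dNN' eps c eps0).2 dc.
exists (q' 0 - q 0) => Y.
have LE j : \sum_i \sum_k L i j k * v 0 i * v 0 k = (q' 0 - q 0) * w 0 j.
  have covE (K : field3 M) (l : R) :
      cov_along K c (velocity_flat g c) a 0 = l *: velocity_flat g c a 0 ->
      derive1 (fun s => velocity_flat g c a s 0 j) 0 -
        \sum_i \sum_k K a p i j k * v 0 i * w 0 k = l * w 0 j.
    by move=> /rowP/(_ j); rewrite [LHS]mxE [RHS]mxE vc wc c0.
  have := covE _ _ cov; have := covE _ _ cov'.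
  move: (derive1 _ _) => d e' e.
  have -> : (q' 0 - q 0) * w 0 j = q' 0 * w 0 j - q 0 * w 0 j by ring.
  rewrite -e' -e opprB addrC addrA subrK -sumrB.
  apply: eq_bigr => i _; rewrite -sumrB.
  have -> : \sum_k (N a p i j k * v 0 i * w 0 k - N' a p i j k * v 0 i * w 0 k) =
      \sum_k \sum_l A a p i j k * g a p k l * v 0 i * v 0 l.
    apply: eq_bigr => k _; rewrite /w mxE !mulr_sumr -sumrB; apply: eq_bigr => l _.
    rewrite /A /conn_sub (metric_symE hg a p l k); ring.
  rewrite exchange_big; apply: eq_bigr => l _; rewrite /L /lower3 !mulr_suml.
  by apply: eq_bigr => k _.
have Y12 : eval3 L v v Y = eval3 L v Y v.
  rewrite eval3_swap23; congr eval3; apply/funext => i; apply/funext => j.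
  by apply/funext => k; rewrite L23.
have -> : eval3 L v v Y = \sum_j Y 0 j * \sum_i \sum_k L i j k * v 0 i * v 0 k.
  rewrite Y12 /eval3 exchange_big; apply: eq_bigr => j _; rewrite mulr_sumr.
  apply: eq_bigr => i _; rewrite mulr_sumr; apply: eq_bigr => k _; ring.
rewrite eval2E mxE mulr_sumr; apply: eq_bigr => j _.
rewrite LE [_^T _ _]mxE -/w; ring.
Qed.

End CompatibleConnections.

(** * Integrability of the Hessian equation *)

Section OverdeterminedHessian.
Context {R : realType} {n : nat}.
Variables (D : set 'rV[R]_n) (v L : 'rV[R]_n -> R)
  (G : 'I_n -> 'I_n -> 'I_n -> 'rV[R]_n -> R) (h : 'rV[R]_n -> 'M[R]_n).
Hypotheses (n2 : (2 <= n)%N) (oD : open D) (sv : smooth_on D v)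
  (sG : forall i j k, smooth_on D (G i j k))
  (sh : forall i j, smooth_on D (fun x => h x i j))
  (uh : forall x, D x -> h x \in unitmx)
  (h_sym : forall x i j, h x i j = h x j i)
  (hii : forall x i, D x -> h x i i != 0)
  (hessE : forall x, D x -> forall i j, partial i (partial j v) x =
     \sum_k G i j k x * partial k v x + n%:R^-1 * h x i j * L x).

Let n0 : n%:R != 0 :> R. Proof. by rewrite pnatr_eq0; case: n n2. Qed.

(** A diagonal entry of the equation expresses L through smooth functions. *)
Lemma smooth_trace_term : smooth_on D L.
Proof.
have i0 : 'I_n by exact: (Ordinal (ltnW n2)).
apply: (@smooth_on_ext _ _ _ (fun x => n%:R * (partial i0 (partial i0 v) x -
    \sum_k G i0 i0 k x * partial k v x) * (h x i0 i0)^-1)) => //.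
  move=> x; rewrite inE => Dx; rewrite hessE// addrAC subrr add0r.
  by have := hii i0 Dx; move: (h x i0 i0) => d d0; field; rewrite n0 d0.
apply: smooth_onM => //; last by apply: smooth_onV => // x; exact: hii.
apply: smooth_onM => //; first exact: smooth_on_cst.
apply: smooth_onD => //; first by do 2 apply: smooth_on_partial.
apply: smooth_onN => //; apply: smooth_on_sum => // k _.
by apply: smooth_onM => //; exact: smooth_on_partial.
Qed.

Let diff (f : 'rV[R]_n -> R) x : smooth_on D f -> D x -> differentiable f x.
Proof. by move=> sf; exact: (sf [::]). Qed.

(** curv and rho are the coefficients of dv and L / n in the third derivatives
   of v. *)
Definition curv (k i j m : 'I_n) x : R :=
  partial k (G i j m) x + \sum_l G i j l x * G k l m x.

Definition rho (k i j : 'I_n) x : R :=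
  \sum_m G i j m x * h x k m + partial k (fun y => h y i j) x.

Lemma third_derivative x k i j : D x -> partial k (partial i (partial j v)) x =
  \sum_m curv k i j m x * partial m v x +
  n%:R^-1 * (rho k i j x * L x + h x i j * partial k L x).
Proof.
move=> Dx.
have nD : \forall y \near x, D y by exact: open_nbhs_nbhs.
rewrite (@near_eq_partial _ _ _ (fun y => \sum_m G i j m y * partial m v y +
  n%:R^-1 * (h y i j * L y))); last first.
  by apply: filterS nD => y Dy; rewrite hessE// mulrA.
have sdv m := smooth_on_partial m sv.
have sL := smooth_trace_term.
have shL : smooth_on D (fun y => h y i j * L y) by exact: smooth_onM.
rewrite partialD; first last.
  by apply: diff Dx; apply: smooth_onM => //; exact: smooth_on_cst.
  by apply: diff Dx; apply: smooth_on_sum => // m _; exact: smooth_onM.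
rewrite partialM; [|exact: differentiable_cst|exact: diff].
rewrite (_ : partial k (fun=> n%:R^-1) x = 0); last exact: partial_cst.
rewrite mul0r addr0 partialM; [|exact: diff..].
have -> : partial k (fun y => \sum_m G i j m y * partial m v y) x =
    \sum_m (G i j m x * partial k (partial m v) x + partial k (G i j m) x * partial m v x).
  have -> : (fun y => \sum_m G i j m y * partial m v y) =
      \sum_m (fun y => G i j m y * partial m v y).
    by apply/funext => y; rewrite fct_sumE.
  rewrite /partial derive_sum; last first.
    by move=> m; apply: diff_derivable; apply: differentiableM;
      [exact: diff (sG i j m) Dx|exact: diff (sdv m) Dx].
  by apply: eq_bigr => m _; rewrite -[RHS]partialM//;
    [exact: diff (sG i j m) Dx|exact: diff (sdv m) Dx].
under eq_bigr do rewrite hessE// mulrDr mulr_sumr.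
rewrite !big_split/= /curv /rho.
under [in RHS]eq_bigr do rewrite mulrDl mulr_suml.
rewrite big_split/=.
have -> : \sum_m \sum_l G i j l x * G k l m x * partial m v x =
    \sum_m \sum_l G i j m x * (G k m l x * partial l v x).
  by rewrite exchange_big; apply: eq_bigr => m _; apply: eq_bigr => l _; ring.
have -> : \sum_m G i j m x * (n%:R^-1 * h x k m * L x) =
    n%:R^-1 * ((\sum_m G i j m x * h x k m) * L x).
  by rewrite mulr_suml mulr_sumr; apply: eq_bigr => m _; ring.
ring.
Qed.

(** The derivatives d_k and d_i commute on d_j v. *)
Lemma integrability x k i j : D x ->
  \sum_m (curv k i j m x - curv i k j m x) * partial m v x +
  n%:R^-1 * ((rho k i j x - rho i k j x) * L x +
    (h x i j * partial k L x - h x k j * partial i L x)) = 0.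
Proof.
move=> Dx; have := partialC k i oD (smooth_on_partial j sv) Dx.
rewrite (third_derivative k i j Dx) (third_derivative i k j Dx) => E.
under eq_bigr do rewrite mulrBl.
by rewrite sumrB; lra.
Qed.

(** contr and contr_rho come from contracting the integrability relation with
   the inverse of h, which solves it for the gradient of L. *)
Definition contr (k m : 'I_n) x : R := - (n%:R / (n%:R - 1)) *
  \sum_i \sum_j invmx (h x) i j * (curv k i j m x - curv i k j m x).

Definition contr_rho (k : 'I_n) x : R := - (n%:R - 1)^-1 *
  \sum_i \sum_j invmx (h x) i j * (rho k i j x - rho i k j x).

Lemma partial_trace_term x k : D x ->
  partial k L x = \sum_m contr k m x * partial m v x + contr_rho k x * L x.
Proof.
move=> Dx.
have n1 : n%:R - 1 != 0 :> R.
  by rewrite subr_eq0 (eqr_nat _ n 1) gtn_eqF.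
have hh : \sum_i \sum_j invmx (h x) i j * h x i j = n%:R.
  transitivity (\tr (invmx (h x) *m h x)).
    by apply: eq_bigr => i _; rewrite mxE; apply: eq_bigr => j _; rewrite h_sym.
  by rewrite mulVmx ?uh// mxtrace1.
have hk : \sum_i \sum_j invmx (h x) i j * (h x k j * partial i L x) = partial k L x.
  transitivity (\sum_i (invmx (h x) *m h x) i k * partial i L x).
    apply: eq_bigr => i _; rewrite mxE mulr_suml; apply: eq_bigr => j _.
    by rewrite (h_sym x k j) mulrA.
  rewrite mulVmx ?uh// (bigD1 k)//= mxE eqxx mul1r big1 ?addr0// => i ik.
  by rewrite mxE (negbTE ik) mul0r.
have : \sum_i \sum_j invmx (h x) i j *
    (\sum_m (curv k i j m x - curv i k j m x) * partial m v x +
    n%:R^-1 * ((rho k i j x - rho i k j x) * L x +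
    (h x i j * partial k L x - h x k j * partial i L x))) = 0.
  by rewrite big1// => i _; rewrite big1// => j _; rewrite integrability// mulr0.
pose S1 := \sum_i \sum_j invmx (h x) i j *
  \sum_m (curv k i j m x - curv i k j m x) * partial m v x.
pose S2 := \sum_i \sum_j invmx (h x) i j * (rho k i j x - rho i k j x).
have -> : \sum_i \sum_j invmx (h x) i j *
    (\sum_m (curv k i j m x - curv i k j m x) * partial m v x +
    n%:R^-1 * ((rho k i j x - rho i k j x) * L x +
    (h x i j * partial k L x - h x k j * partial i L x))) =
    S1 + n%:R^-1 * (S2 * L x + (n%:R * partial k L x - partial k L x)).
  pose Q (F : 'I_n -> 'I_n -> R) := \sum_i \sum_j invmx (h x) i j * F i j.
  have QD F F' : Q (fun i j => F i j + F' i j) = Q F + Q F'.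
    rewrite -big_split; apply: eq_bigr => i _; rewrite -big_split.
    by apply: eq_bigr => j _; rewrite mulrDr.
  have QZ c F : Q (fun i j => c * F i j) = c * Q F.
    rewrite mulr_sumr; apply: eq_bigr => i _; rewrite mulr_sumr.
    by apply: eq_bigr => j _; rewrite mulrCA.
  rewrite -!/(Q _) QD QZ QD; congr (_ + _ * (_ + _)).
    rewrite [RHS]mulrC -[S2]/(Q _) -QZ.
    by apply: eq_bigr => i _; apply: eq_bigr => j _; congr (_ * _); exact: mulrC.
  (* n is the contraction of h, and d_k L the one of h_kj d_i L. *)
  rewrite -{3}hk -hh -[X in X * _]/(Q _) -[X in _ - X]mul1r -mulNr [X in X + _]mulrC.
  rewrite -[X in _ + _ * X]/(Q _) -!QZ -QD.
  by apply: eq_bigr => i _; apply: eq_bigr => j _; congr (_ * _); ring.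
have -> : \sum_m contr k m x * partial m v x = - (n%:R / (n%:R - 1)) * S1.
  rewrite /S1 /contr.
  under eq_bigr do rewrite -mulrA mulr_suml.
  rewrite -mulr_sumr; congr (_ * _); rewrite exchange_big; apply: eq_bigr => i _ /=.
  under eq_bigr do rewrite mulr_suml.
  rewrite exchange_big; apply: eq_bigr => j _ /=; rewrite mulr_sumr.
  by apply: eq_bigr => m _; rewrite mulrA.
rewrite /contr_rho -/S2 => E.
have {}E : partial k L x * (n%:R - 1) = - (n%:R * S1) - S2 * L x.
  apply/eqP; rewrite -subr_eq0; apply/eqP; rewrite -[RHS](mulr0 n%:R) -E; field.
  exact: n0.
rewrite -[LHS](mulfK n1) E; field; exact: n1.
Qed.

Lemma smooth_curv k i j m : smooth_on D (curv k i j m).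
Proof.
apply: smooth_onD => //; first exact: smooth_on_partial.
by apply: smooth_on_sum => // l _; exact: smooth_onM.
Qed.

Lemma smooth_rho k i j : smooth_on D (rho k i j).
Proof.
apply: smooth_onD => //; last exact: smooth_on_partial.
by apply: smooth_on_sum => // l _; exact: smooth_onM.
Qed.

Lemma smooth_contr k m : smooth_on D (contr k m).
Proof.
apply: smooth_onM => //; first exact: smooth_on_cst.
apply: smooth_on_sum => // i _; apply: smooth_on_sum => // j _.
apply: smooth_onM => //; first exact: smooth_on_invmx.
by apply: smooth_onD; [|exact: smooth_curv|apply: smooth_onN => //; exact: smooth_curv].
Qed.

Lemma smooth_contr_rho k : smooth_on D (contr_rho k).
Proof.
apply: smooth_onM => //; first exact: smooth_on_cst.
apply: smooth_on_sum => // i _; apply: smooth_on_sum => // j _.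
apply: smooth_onM => //; first exact: smooth_on_invmx.
by apply: smooth_onD; [|exact: smooth_rho|apply: smooth_onN => //; exact: smooth_rho].
Qed.

(** The n + 2 functions v, d_i v and L solve a total linear system of first
   order with continuous coefficients. *)
Lemma overdetermined_unique x0 : D x0 ->
  v x0 = 0 -> (forall i, partial i v x0 = 0) -> L x0 = 0 ->
  \forall x \near x0, v x = 0.
Proof.
move=> Dx0 v0 dv0 L0.
pose I := ('I_n + bool)%type.
pose f (s : I) := match s with
  inl j => partial j v | inr true => v | inr false => L end.
pose A (i : 'I_n) (s t : I) : 'rV[R]_n -> R := match s, t with
  | inl j, inl l => G i j l
  | inl j, inr true => cst 0
  | inl j, inr false => fun x => n%:R^-1 * h x i j
  | inr true, inl l => cst (i == l)%:R
  | inr true, inr _ => cst 0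
  | inr false, inl m => contr i m
  | inr false, inr true => cst 0
  | inr false, inr false => contr_rho i
  end.
have sf s : smooth_on D (f s).
  by case: s => [j|[]]; [exact: smooth_on_partial|exact: sv|exact: smooth_trace_term].
have sA i s t : smooth_on D (A i s t).
  case: s => [j|[]]; case: t => [l|[]]; rewrite /A//; try exact: smooth_on_cst.
  - by apply: smooth_onM => //; exact: smooth_on_cst.
  - exact: smooth_contr.
  - exact: smooth_contr_rho.
have nD : \forall x \near x0, D x by exact: open_nbhs_nbhs.
have : \forall x \near x0, forall s, f s x = 0.
  apply: (@unique_continuation _ _ I f A).
  - by apply: filterS nD => x Dx s; exact: diff.
  - by move=> i s t; apply: differentiable_continuous; exact: diff.
  - apply: filterS nD => x Dx i s; rewrite big_sumType/= big_bool/=.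
    case: s => [j|[]] /=.
    + by rewrite hessE// mul0r add0r.
    + rewrite !mul0r !addr0 (bigD1 i)//= /cst eqxx mul1r big1 ?addr0// => l li.
      by rewrite eq_sym (negbTE li) mul0r.
    + by rewrite partial_trace_term// mul0r add0r.
  - by case=> [j|[]] /=.
by apply: filterS => x /(_ (inr true)).
Qed.

(** Where dv = 0, both the relation and the formula for the gradient of L
   have L as a factor. *)
Lemma integrability_critical x k i j : D x ->
  (forall m, partial m v x = 0) -> L x != 0 ->
  rho k i j x - rho i k j x + h x i j * contr_rho k x - h x k j * contr_rho i x = 0.
Proof.
move=> Dx dv0 L0.
have z (c : 'I_n -> R) : \sum_m c m * partial m v x = 0.
  by rewrite big1// => m _; rewrite dv0 mulr0.
have := integrability k i j Dx; rewrite !partial_trace_term// !z !add0r => E.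
have nL : n%:R^-1 * L x != 0 by rewrite mulf_neq0// invr_eq0.
by apply: (mulfI nL); rewrite mulr0 -[RHS]E; ring.
Qed.

End OverdeterminedHessian.

(** * Total symmetry of B *)

Section StructureTensor.
Context {R : realType} {n : nat} (M : smooth_manifold R n).
Variables (g : field2 M) (nabla That : field3 M).
Hypotheses (n2 : (2 <= n)%N) (hg : riemannian_metric g)
  (lc : levi_civita g nabla) (hT : tensor12 That).
Implicit Types (a b : chart M) (p q : M).

Definition hessian_equation (V : M -> R) := forall a p, dom a p -> forall i j,
  hessian nabla V a p i j =
    \sum_k That a p i j k * differential V a p 0 k
    + n%:R^-1 * g a p i j * laplacian g nabla V a p.

(* The coordinate expressions in the chart a of the data of the equation. *)
Let vv a (V : M -> R) := V \o param a.
Let GG a i j k x := nabla a (param a x) i j k + That a (param a x) i j k.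
Let hh a x := g a (param a x).
Let LL a (V : M -> R) x := laplacian g nabla V a (param a x).

Let smooth_GG a i j k : smooth_on (chart_image a) (GG a i j k).
Proof.
have [[sN _ _] _ _] := lc; have [sT _ _] := hT.
by apply: smooth_onD; [exact: image_open|exact: sN|exact: sT].
Qed.

Let smooth_hh a i j : smooth_on (chart_image a) (fun x => hh a x i j).
Proof. by have [[sg _ _] _ _] := hg; exact: sg. Qed.

Let unit_hh a x : chart_image a x -> hh a x \in unitmx.
Proof. by move=> /coord_param[ax _]; exact: metric_unit. Qed.

Let hh_sym a x i j : hh a x i j = hh a x j i.
Proof. exact: metric_symE. Qed.

Lemma eval2_delta (h : 'M[R]_n) i j : eval2 h (delta_mx 0 i) (delta_mx 0 j) = h i j.
Proof.
by rewrite eval2E -rowE mxE (bigD1 j)//= !mxE !eqxx mulr1 big1 ?addr0// => k kj;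
  rewrite !mxE (negbTE kj) mulr0.
Qed.

Let hh_diag a x i : chart_image a x -> hh a x i i != 0.
Proof.
move=> /coord_param[ax _]; have [_ _ gpos] := hg.
have := gpos a _ ax (delta_mx 0 i); rewrite eval2_delta => gi.
apply: lt0r_neq0; apply: gi; apply/eqP => /rowP/(_ i)/eqP.
by rewrite !mxE !eqxx oner_eq0.
Qed.

Let hessE a V : hessian_equation V -> forall x, chart_image a x -> forall i j,
  partial i (partial j (vv a V)) x =
  \sum_k GG a i j k x * partial k (vv a V) x + n%:R^-1 * hh a x i j * LL a V x.
Proof.
move=> eV x Dx i j; have [ax cx] := coord_param Dx.
have := eV a _ ax i j; rewrite [hessian _ _ _ _ _ _]mxE.
have dV k q : differential V a q 0 k = partial k (vv a V) (coord a q) by rewrite mxE.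
rewrite {1}/pd cx.
have -> : partial i ((fun q => differential V a q 0 j) \o param a) x =
    partial i (partial j (vv a V)) x.
  have nx := near_chart_image ax; rewrite cx in nx; apply: near_eq_partial.
  by apply: filterS nx => y /coord_param[_ cy]; rewrite /= dV cy.
move/eqP; rewrite subr_eq => /eqP ->; rewrite addrAC -big_split; congr (_ + _).
by apply: eq_bigr => k _; rewrite dV cx /= /GG; ring.
Qed.

(** The set of the points near which V vanishes is open.  It is closed since
   V, dV and the Laplacian are continuous: they vanish on its closure, and
   unique continuation applies there. *)
Lemma hessian_solution_eq0 V a p : connected [set: M] -> smooth_fun V ->
  hessian_equation V -> dom a p -> V p = 0 -> (forall i, pd a i V p = 0) ->
  laplacian g nabla V a p = 0 -> forall q, V q = 0.
Proof.
move=> cM sV eV ap Vp dVp Lp.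
pose Z : set M := [set q : M | \forall r \near q, V r = 0].
have local b q : dom b q -> V q = 0 -> (forall i, pd b i V q = 0) ->
    laplacian g nabla V b q = 0 -> Z q.
  move=> bq Vq dVq Lq.
  have : \forall x \near coord b q, vv b V x = 0.
    apply: (overdetermined_unique n2 (@image_open _ _ M b) (sV b)
      (@smooth_GG b) (@smooth_hh b) (@unit_hh b) (@hh_sym b) (@hh_diag b) (hessE eV)).
    - by exists q.
    - by rewrite /vv /= coordK.
    - by [].
    - by rewrite /LL coordK.
  move=> nx; have nq := coord_continuous bq nx.
  by apply: filterS2 (near_dom bq) nq => r br; rewrite /vv/= coordK.
have i0 : 'I_n by exact: (Ordinal (ltnW n2)).
have jet b q : Z q -> dom b q -> [/\ vv b V (coord b q) = 0,
    forall i, partial i (vv b V) (coord b q) = 0 & LL b V (coord b q) = 0].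
  move=> Zq bq; have nx : \forall x \near coord b q, vv b V x = 0 by exact: (near_param bq Zq).
  have d1 i : \forall x \near coord b q, partial i (vv b V) x = 0.
    apply: filterS (nbhs_interior nx) => y ny.
    by rewrite (@near_eq_partial _ _ _ (cst 0))// partial_cst.
  have Dq : chart_image b (coord b q) by exists q.
  split; [exact: (nbhs_singleton nx)|by move=> i; exact: (nbhs_singleton (d1 i))|].
  have := hessE eV Dq i0 i0.
  rewrite (near_eq_partial i0 (h := cst 0) (d1 i0)) partial_cst big1 ?add0r; last first.
    by move=> k _; rewrite (nbhs_singleton (d1 k)) mulr0.
  have c0 : n%:R^-1 * hh b (coord b q) i0 i0 != 0.
    apply: mulf_neq0; last exact: hh_diag.
    by rewrite invr_eq0 pnatr_eq0 (gtn_eqF (ltnW n2)).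
  move: c0; move: (n%:R^-1 * _) (LL b V _) => c l c0 /esym/eqP.
  by rewrite mulf_eq0 (negbTE c0) => /eqP.
have Zopen : open Z by rewrite openE => q /nbhs_interior.
have Zclosed : closed Z.
  move=> q Zq; have [b bq] := dom_cover q.
  have vanish (f : 'rV[R]_n -> R) : {for coord b q, continuous f} ->
      (forall r, Z r -> dom b r -> f (coord b r) = 0) -> f (coord b q) = 0.
    move=> cf f0; apply/eqP; apply/negPn/negP => fq.
    have nf : \forall x \near coord b q, f x != 0.
      exact: (cvgr_neq0 _ cf fq).
    have nr : \forall r \near q, f (coord b r) != 0 := coord_continuous bq nf.
    have [r [Zr [fr br]]] := Zq _ (filterI nr (near_dom bq)).
    by move: fr => /=; rewrite f0// eqxx.
  have Dq : chart_image b (coord b q) by exists q.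
  have cts (f : 'rV[R]_n -> R) : smooth_on (chart_image b) f ->
      {for coord b q, continuous f}.
    by move=> sf; apply: differentiable_continuous; exact: (sf [::]).
  apply: (local b q bq).
  - rewrite -[q in V q](coordK bq) -[LHS]/(vv b V (coord b q)).
    by apply: vanish => [|r Zr br]; [exact/cts/sV|have [] := jet b r Zr br].
  - move=> i; rewrite -[LHS]/(partial i (vv b V) (coord b q)).
    apply: vanish => [|r Zr br]; first by apply: cts; exact/smooth_on_partial/sV.
    by have [] := jet b r Zr br.
  - rewrite -[q in laplacian _ _ _ _ q](coordK bq) -[LHS]/(LL b V (coord b q)).
    apply: vanish => [|r Zr br]; last by have [] := jet b r Zr br.
    apply: cts; exact: (smooth_trace_term n2 (@image_open _ _ M b) (sV b)
      (@smooth_GG b) (@smooth_hh b) (@hh_diag b) (hessE eV)).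
have ZT : Z = [set: M].
  apply: cM; first by exists p; exact: (local a).
  - by exists Z => //; rewrite setTI.
  - by exists Z => //; rewrite setTI.
by move=> q; have : Z q; [rewrite ZT|exact: nbhs_singleton].
Qed.

(** All Christoffel symbols cancel, by metricity and torsion-freeness. *)
Let rhoE a p k i j : dom a p ->
  rho (GG a) (hh a) k i j (coord a p) - rho (GG a) (hh a) i k j (coord a p) =
  lower3 g That a p i j k - lower3 g That a p k j i.
Proof.
move=> ap.
have dg k' i' j' : partial k' (fun y => hh a y i' j') (coord a p) =
    \sum_m nabla a p k' i' m * g a p m j' + \sum_m nabla a p k' j' m * g a p m i'.
  have := levi_civita0 k' i' j' lc ap; rewrite /cov2 /pd.
  have -> : \sum_m nabla a p k' j' m * g a p i' m = \sum_m nabla a p k' j' m * g a p m i'.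
    by apply: eq_bigr => m _; rewrite (metric_symE hg a p m).
  by move=> /subr0_eq <-; rewrite addrC subrK.
have GGE i' j' k' : \sum_m GG a i' j' m (coord a p) * hh a (coord a p) k' m =
    \sum_m nabla a p i' j' m * g a p m k' + lower3 g That a p i' j' k'.
  rewrite /lower3 -big_split; apply: eq_bigr => m _ /=.
  by rewrite /GG /hh coordK// (metric_symE hg a p k'); ring.
have [_ tN _] := lc.
have NE i' j' k' : \sum_m nabla a p i' j' m * g a p m k' =
    \sum_m nabla a p j' i' m * g a p m k'.
  by apply: eq_bigr => m _; rewrite tN.
rewrite /rho !GGE !dg (NE i k j); ring.
Qed.

Let tau a p k := \sum_j That a p k j j.

(** The integrability relation at a critical point of V.  Contracted
   with the inverse metric, the antisymmetrization of rho gives minus the trace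
   of That, because That is trace-free in its covariant arguments. *)
Lemma B_tensor_swap13 V a p : smooth_fun V -> hessian_equation V -> dom a p ->
  (forall i, pd a i V p = 0) -> laplacian g nabla V a p != 0 ->
  (forall k, \sum_i \sum_j invmx (g a p) i j * That a p i j k = 0) ->
  forall i j k, B_tensor g That a p i j k = B_tensor g That a p k j i.
Proof.
move=> sV eV ap dVp Lp trT i j k.
have Dp : chart_image a (coord a p) by exists p.
have hp : hh a (coord a p) = g a p by rewrite /hh coordK.
have ug := metric_unit hg ap.
have cE k' : contr_rho (GG a) (hh a) k' (coord a p) = (n%:R - 1)^-1 * tau a p k'.
  rewrite /contr_rho mulNr -mulrN; congr (_ * _); rewrite hp.
  under eq_bigr => i' _ do under eq_bigr => j' _ do rewrite rhoE// mulrBr.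
  under eq_bigr => i' _ do rewrite sumrB.
  rewrite sumrB.
  have -> : \sum_i \sum_j invmx (g a p) i j * lower3 g That a p i j k' =
      \sum_m (\sum_i \sum_j invmx (g a p) i j * That a p i j m) * g a p m k'.
    under [RHS]eq_bigr => m _ do rewrite mulr_suml.
    rewrite [RHS]exchange_big; apply: eq_bigr => i' _.
    under [RHS]eq_bigr => m _ do rewrite mulr_suml.
    rewrite [RHS]exchange_big; apply: eq_bigr => j' _.
    by rewrite /lower3 mulr_sumr; apply: eq_bigr => m _; rewrite mulrA.
  rewrite big1 ?sub0r ?opprK; last by move=> m _; rewrite trT mul0r.
  rewrite exchange_big; apply: eq_bigr => j' _ /=.
  transitivity (((\row_m That a p k' j' m) *m g a p *m invmx (g a p)) 0 j').
    rewrite [RHS]mxE; apply: eq_bigr => i' _; rewrite mulrC; congr (_ * _).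
    by rewrite /lower3 mxE; apply: eq_bigr => m _; rewrite mxE.
  by rewrite mulmxK// mxE.
have dv0 m : partial m (vv a V) (coord a p) = 0 by exact: dVp.
have L0 : LL a V (coord a p) != 0 by rewrite /LL coordK.
have := integrability_critical n2 (@image_open _ _ M a) (sV a)
  (@smooth_GG a) (@smooth_hh a) (@unit_hh a) (@hh_sym a) (@hh_diag a) (hessE eV)
  k i j Dp dv0 L0.
rewrite rhoE// !cE hp /B_tensor !mxE -!/(tau _ _ _).
have n0 : n%:R != 0 :> R by rewrite pnatr_eq0 (gtn_eqF (ltnW n2)).
have n1 : n%:R - 1 != 0 :> R by rewrite subr_eq0 (eqr_nat _ n 1) gtn_eqF.
have n2' : n%:R + 2 != 0 :> R by rewrite -natrD pnatr_eq0 addn_eq0 andbF.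
have e x : (n%:R + 2) / n%:R * x * (n%:R / ((n%:R - 1) * (n%:R + 2)) * tau a p k) =
   x * ((n%:R - 1)^-1 * tau a p k) by field; rewrite n0 n2' n1.
have e' x : (n%:R + 2) / n%:R * x * (n%:R / ((n%:R - 1) * (n%:R + 2)) * tau a p i) =
   x * ((n%:R - 1)^-1 * tau a p i) by field; rewrite n0 n2' n1.
rewrite e e' => E; apply/eqP; rewrite -subr_eq0 -E; apply/eqP; ring.
Qed.

(** There are n + 1 linear conditions on a space of dimension n + 2. *)
Lemma exists_critical_potential (VV : set (M -> R)) a p :
  linear_subspace VV -> has_dim VV (n + 2)%N -> (forall V, VV V -> smooth_fun V) ->
  dom a p -> exists V, [/\ VV V, exists q, V q != 0, V p = 0 &
    forall i, pd a i V p = 0].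
Proof.
move=> [VV0 VVlin] [b [bVV bfree _]] sVV ap.
pose E : 'M[R]_(n + 2, 1 + n) :=
  row_mx (\col_i b i p) (\matrix_(i, j) pd a j (b i) p).
have : kermx E != 0.
  rewrite kermx_eq0; apply/negP => /eqP rf.
  by have := rank_leq_col E; rewrite rf (addnC 1%N) leq_add2l.
move=> /rowV0Pn[c /sub_kermxP cE c0].
move: cE; rewrite mul_mx_row -[RHS](@row_mx0 _ 1 1 n) => /eq_row_mx[cb cd].
exists (\sum_i c 0 i *: b i).
have VVsum (r : seq 'I_(n + 2)) : VV (\sum_(i <- r) c 0 i *: b i).
  by elim/big_ind: _ => // [u w Vu Vw|i _]; [rewrite -[u]scale1r; exact: VVlin|
    rewrite -[X in VV X]addr0; exact: VVlin].
split=> //.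
- apply: contrapT => nV; move/eqP: c0; apply; apply/rowP => i; rewrite mxE.
  apply: (bfree (c 0)); apply/funext => q; apply/eqP; apply: contrapT => Vq.
  by apply: nV; exists q; apply/negP.
- rewrite fct_sumE; have := congr1 (fun m : 'rV[R]_1 => m 0 0) cb.
  by rewrite !mxE => cb'; rewrite -[RHS]cb'; apply: eq_bigr => i _; rewrite mxE.
- move=> j; have := congr1 (fun m : 'rV[R]_n => m 0 j) cd.
  rewrite !mxE => cd'; rewrite -[RHS]cd' /pd /partial.
  have -> : (\sum_i c 0 i *: b i) \o param a = \sum_i (c 0 i *: (b i \o param a)).
    by apply/funext => x; rewrite /comp !fct_sumE.
  have db i : derivable (b i \o param a) (coord a p) (delta_mx 0 j).
    by apply: diff_derivable; apply: smooth_comp_diff => //; exact: sVV.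
  rewrite derive_sum; last by move=> i; exact: derivableZ.
  by apply: eq_bigr => i _; rewrite deriveZ// mxE.
Qed.

End StructureTensor.

(** * Dual-projective uniqueness of nabla^B *)

Theorem theorem1 (R : realType) (n : nat) (M : smooth_manifold R n)
    (g : field2 M) (nabla : field3 M)
    (KK : set (field2 M)) (VV : set (M -> R)) (That : field3 M)
    (hn : (2 <= n)%N)
    (hsys : nondegenerate_system g nabla KK VV)
    (hT : structure_tensor g nabla VV That) :
  let nablaT := conn_sub nabla That in
  let nablaB := conn_sub nabla (Bhat g That) in
  let star (N : field3 M) :=
    [/\ affine_connection N, torsion_free N,
        dual_projectively_equivalent g N nablaT & compatible N g] in
  (forall (eps : R) (c : R -> M), 0 < eps ->
     (dual_geodesic g nablaT eps c <-> dual_geodesic g nablaB eps c)) /\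
  ((exists! N : field3 M, star N) /\ star nablaB).
Proof.
move=> nablaT nablaB star.
have hg := nds_metric hsys; have lc := nds_levi_civita hsys.
have [aN tN _] := lc; have [tT Tsym Ttr Thess] := hT.
have aB : affine_connection nablaB by exact/affine_conn_sub/tensor12_Bhat.
have geo eps c : dual_geodesic g nablaT eps c <-> dual_geodesic g nablaB eps c.
  split; [apply: (dual_geodesic_shift (s := - ((n%:R + 2) / n%:R)) hg tT)|
          apply: (dual_geodesic_shift (s := (n%:R + 2) / n%:R) hg tT)];
  by move=> a p ap i j k; rewrite /nablaB /nablaT /conn_sub BhatE//; ring.
have B12 a p i j k : B_tensor g That a p i j k = B_tensor g That a p j i k.
  rewrite /B_tensor (metric_symE hg a p i j); congr (_ + _).
  by apply: eq_bigr => m _; rewrite Tsym.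
have B13 a p : dom a p ->
    forall i j k, B_tensor g That a p i j k = B_tensor g That a p k j i.
  move=> ap.
  have [V [VVV [q Vq] Vp dVp]] := exists_critical_potential
    (nds_V_subspace hsys) (nds_V_dim hsys) (nds_V_smooth hsys) ap.
  have sV := nds_V_smooth hsys VVV; have eV := Thess V VVV.
  apply: (B_tensor_swap13 hn hg lc tT sV eV ap dVp _ (Ttr a p ap)).
  apply: contra_neq Vq => Lp.
  exact: (hessian_solution_eq0 hn hg lc tT (nds_connected hsys) sV eV ap Vp dVp Lp q).
have starB : star nablaB.
  split=> //.
  - move=> a p i j k; rewrite /nablaB /conn_sub tN; congr (_ - _).
    by apply: eq_bigr => l _; rewrite B12.
  - by move=> eps c _; split=> /geo.
  - have low a p i j k (ap : dom a p) :
        lower3 g (Bhat g That) a p i j k = B_tensor g That a p i j k.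
      exact: lower_raise.
    apply: (compatible_sub hg lc) => a p ap i j k; rewrite !low//.
    by rewrite B12 B13// B12.
split=> //; split=> //; exists nablaB; split=> // N [aN' tN' eqN cN].
have [_ tB eqB cB] := starB.
apply/esym/(compatible_unique hg hn) => // eps c eps0.
exact: iff_trans (eqN eps c eps0) (iff_sym (eqB eps c eps0)).
Qed.
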